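(* Let $d\ge 2$ be an integer and let $\mathbb{F}$ be a field. Let $1>\beta=\beta_d>0$ be the unique positive root of the equation $$-\ln(1-\beta)=\frac{(d+1)\cdot\beta}{d+1-d\cdot\beta},$$ and let $c^{\ast}_d$ be defined as $$c^{\ast}_d=\frac{-\ln(1-\beta)}{\beta^d}.$$ If $c>c^{\ast}_d$, then a complex $X$ drawn from $X_d(n,\frac{c}{n})$ satisfies asymptotically almost surely (that is, with probability tending to $1$ as $n\to\infty$) $$H_d(X;\mathbb{F})\neq 0.$$ Specifically, $c^{\ast}_2=2.75381$ and $c^{\ast}_3=3.90708$. Also $\beta_2=0.883414$ and $\beta_3=0.972498$. For large $d$, $$c^{\ast}_d=(d+1)-\frac{d^2+d+1}{\exp(d+1)}+O\!\left(\frac{d^2}{\exp(2d)}\right)$$ and $$\beta_d=1-\exp(-(d+1))-(1+o_d(1))\frac{(d+1)^2}{\exp(2(d+1))},$$ where $o_d(1)$ denotes a quantity tending to $0$ as $d\to\infty$.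
   Context: $X_d(n,p)$ is the following model of random $d$-dimensional simplicial complexes on $n$ vertices: $X\sim X_d(n,p)$ contains the full $(d-1)$-dimensional skeleton (every nonempty set of at most $d$ vertices is a face), and each of the $\binom{n}{d+1}$ possible $d$-faces (vertex sets of size $d+1$) is included independently with probability $p$; there are no faces of dimension greater than $d$. $H_d(X;\mathbb{F})$ is the $d$-th homology group of $X$ with coefficients in $\mathbb{F}$. The integer $d$, the arbitrary field $\mathbb{F}$ and the constant $c$ are fixed as $n\to\infty$.
   Formalization: The printed large-d expansion of c*_d is false and is replaced by c*_d=(d+1)-(d+1)/exp(d+1)+O(d^3/exp(2d)): the coefficient d^2+d+1 becomes d+1 and the error O(d^2/exp(2d)) becomes O(d^3/exp(2d)); the decimals are read as roundings. *)

(* Defs.v *)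
From HB Require Import structures.
From mathcomp Require Import all_boot all_order all_algebra.
From mathcomp Require Import ring_quotient.
From mathcomp Require Import all_classical all_reals all_analysis.
Set Implicit Arguments.
Unset Strict Implicit.
Unset Printing Implicit Defensive.
Import Order.TTheory GRing.Theory Num.Theory.
Import numFieldNormedType.Exports.
Local Open Scope ring_scope.

(* A simplicial complex on the vertex set 'I_n is given by its set of nonempty
   faces X : {set {set 'I_n}}; a face of dimension k has k.+1 vertices.       *)
Section Homology.
Variables (F : fieldType) (n : nat) (X : {set {set 'I_n}}).

Definition face (k : nat) : finType :=
  {s : {set 'I_n} | (s \in X) && (#|s| == k.+1)}.

Definition chain (k : nat) : vectType F := {ffun face k -> F^o}.

(* Coefficient of t in the boundary of s, oriented by the order of 'I_n:
   the boundary of v_0 < ... < v_k is the sum of the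
   (-1)^i [v_0, ..., v_(i-1), v_(i+1), ..., v_k].                             *)
Definition incidence (s t : {set 'I_n}) : F :=
  \sum_(v in s | s :\ v == t) (-1) ^+ #|[set u in s | (u < v)%N]%SET|.

Definition boundary (k : nat) (c : chain k.+1) : chain k :=
  [ffun t : face k => \sum_(s : face k.+1) incidence (val s) (val t) * c s].

Lemma boundary_is_linear k : linear (@boundary k).
Proof.
move=> a x y; apply/ffunP => t; rewrite !ffunE /= scaler_sumr -big_split /=.
by apply: eq_bigr => s _; rewrite !ffunE mulrDr mulrCA.
Qed.

HB.instance Definition _ k :=
  GRing.isLinear.Build F (chain k.+1) (chain k) *:%R (@boundary k)
    (@boundary_is_linear k).

Definition cycles (k : nat) : {vspace chain k} :=
  match k with
  | 0 => fullv
  | k'.+1 => lker (linfun (@boundary k'))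
  end.

Definition boundaries (k : nat) : {vspace chain k} :=
  limg (linfun (@boundary k)).

Definition boundaries_in_cycles (k : nat) : {vspace subvs_of (cycles k)} :=
  (linfun vsval @^-1: boundaries k)%VS.

(* MathComp has no quotient vector spaces: H_k is the quotient of the additive
   group of k-cycles, which suffices to say whether it vanishes.              *)
Definition homology (k : nat) : zmodType :=
  Quotient.quot (boundaries_in_cycles k).

End Homology.

Section RandomComplex.
Variables (R : realType) (n d : nat).

Definition top_faces : {set {set 'I_n}} := [set s : {set 'I_n} | #|s| == d.+1]%SET.

Definition with_skeleton (T : {set {set 'I_n}}) : {set {set 'I_n}} :=
  [set s : {set 'I_n} | (0 < #|s| <= d)%N]%SET :|: T.

(* Probability that X ~ X_d(n, p) satisfies E; a probability when 0 <= p <= 1,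
   which for p = c / n holds as soon as n >= c.                               *)
Definition prob_Xd (p : R) (E : {set {set 'I_n}} -> Prop) : R :=
  \sum_(T in powerset top_faces | `[< E (with_skeleton T) >])
     \prod_(s in top_faces) (if s \in T then p else 1 - p).

End RandomComplex.

Section Threshold.
Variable R : realType.

(* ln x = 0 for x <= 0 in the library, hence the explicit b < 1. *)
Definition is_beta (d : nat) (b : R) : Prop :=
  0 < b < 1 /\ - ln (1 - b) = (d%:R + 1) * b / (d%:R + 1 - d%:R * b).

Definition beta (d : nat) : R := xget 0 [set b | is_beta d b]%classic.

Definition cstar (d : nat) : R := - ln (1 - beta d) / beta d ^+ d.

End Threshold.

(* Main.v *)
Require Import Defs.
From HB Require Import structures.
From mathcomp Require Import all_boot all_order all_algebra.
From mathcomp Require Import all_classical all_reals all_analysis.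
(* Finite sets again, so that their names prevail over those of classical sets. *)
From mathcomp Require Import fintype finset perm ring_quotient ring lra zify.
Import Order.TTheory GRing.Theory Num.Theory.
Import numFieldNormedType.Exports.
Set Implicit Arguments.
Unset Strict Implicit.
Unset Printing Implicit Defensive.

(** Call the (d-1)-faces ridges, and the d-faces simply faces.  If T is a set of
    ridges and more than #|T| faces have all their facets in T, then counting
    dimensions gives a nonzero cycle supported on those faces, over any field.
    So the homology is nonzero as soon as the least size of a vertex cover of the
    incidence graph between the faces of X and the ridges is smaller than the
    number of faces (homology_of_cover).  Like a matrix rank, this cover number is
    submodular, but it does not see the field and it is invariant under all
    permutations of the vertices.

    Its expectation is bounded by interpolation.  Each ridge t also gets, at
    random, a unit row that only t can cover.  Along a path with parameter x the
    faces enter while the unit rows leave; at x = 0 there are unit rows only, whose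
    expected number is trivial, and at x = 1 there is the random complex.  Call a
    ridge frozen when some minimum cover contains it: its unit row is then free,
    and a face is free if all its facets are frozen.  Being frozen is an increasing
    event and, by symmetry, has the same probability r for all ridges.  By the
    Harris inequality a new face is free with probability at least r ^ (d + 1).
    The derivative along the path is therefore at most
    a 'C(n, d+1) (1 - r ^ (d+1)) - l 'C(n, d) (1 - r), where a and l are the rates of
    the faces and of the unit rows.  If l 'C(n, d) equals a 'C(n, d+1) times the slope of
    r ^ (d+1) at a point b, the unknown r disappears by convexity (mean_cover_le).  With b = beta
    the resulting bound on the cover number falls below the expected number of
    faces by a positive multiple of 'C(n, d) when c > cstar
    (cstar_excess).  Adding one face changes the difference by at most 1, so an
    Efron-Stein variance bound and Chebyshev's inequality conclude
    (prob_homology_cvg).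

    The assertions about beta and cstar are calculus.  With u = 1 - b the defining
    equation is beta_eqn d u = 0, where beta_eqn d vanishes with its derivative at 1
    and its second derivative vanishes only at 1 / d; Rolle's theorem leaves room
    for a single root in the open unit interval.  Sign changes of beta_eqn d, checked with
    rational bounds on the exponential, locate that root for d = 2 and d = 3.  For
    large d the root lies between e and 2 e, where e = expR (- (d + 1)), and the
    equation u = e * expR ((d+1)^2 u / (1 + d u)) turns this into both
    expansions. *)

(** * Minimum covers *)

Lemma subset_ind (I : finType) (P : {set I} -> Prop) :
    P set0 -> (forall i (S : {set I}), i \notin S -> P S -> P (i |: S)) ->
  forall S, P S.
Proof.
move=> P0 PS S; have [m] := ubnP #|S|; elim: m S => // m IH S.
have [->|[i iS]] := set_0Vmem S; first by [].
rewrite (cardsD1 i) iS ltnS => ltSm; rewrite -(setD1K iS).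
by apply: PS; [rewrite !inE eqxx | exact: IH].
Qed.

Section Cover.
Variables (I J : finType) (N : I -> {set J}).
Implicit Types (A B : {set I}) (T : {set J}).

Definition cover_cost A T : nat := #|T| + #|[set i in A | ~~ (N i \subset T)]|.

(** The least size of a vertex cover of the bipartite graph that joins each row
    i in A to the columns in N i; by Koenig's theorem also the largest rank of a
    matrix whose rows are supported in the N i. *)
Definition cover_num A : nat := cover_cost A [arg min_(T < set0) cover_cost A T].

Definition min_cover A T := cover_cost A T == cover_num A.

(** This union is itself a minimum cover (min_cover_closure), hence the largest
    one.  It is to the cover number what the span is to the rank. *)
Definition cover_closure A : {set J} := \bigcup_(T | min_cover A T) T.

Lemma cover_num_le A T : cover_num A <= cover_cost A T.
Proof. by rewrite /cover_num; case: arg_minnP => // T0 _; apply. Qed.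

Lemma min_coverP A : exists T, min_cover A T.
Proof. by exists [arg min_(T < set0) cover_cost A T]; rewrite /min_cover eqxx. Qed.

Lemma min_coverE A T : min_cover A T = (cover_cost A T <= cover_num A).
Proof. by rewrite /min_cover eqn_leq cover_num_le andbT. Qed.

Lemma cover_cost_sum A T :
  cover_cost A T = #|T| + \sum_i ((i \in A) && ~~ (N i \subset T)).
Proof.
rewrite /cover_cost; congr (_ + _); rewrite -sum1_card big_mkcond /=.
by apply: eq_bigr => i _; rewrite inE; case: ifP.
Qed.

Lemma cover_cost_mono A B T : A \subset B -> cover_cost A T <= cover_cost B T.
Proof.
move=> sAB; rewrite leq_add2l; apply: subset_leq_card.
by apply/subsetP => i; rewrite !inE => /andP[/(subsetP sAB) -> ->].
Qed.

Lemma cover_num_mono A B : A \subset B -> cover_num A <= cover_num B.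
Proof.
move=> sAB; have [T /eqP <-] := min_coverP B.
exact: leq_trans (cover_num_le A T) (cover_cost_mono _ sAB).
Qed.

(** A row of A supported in just one of T and T' costs 1 on the right, and on the
    left only the intersection can charge for it; one supported in neither costs 2
    on the right.  A row of B outside A is charged for T' on the right, and at most
    for the union on the left.  Allowing A to be smaller than B makes the inequality
    serve for two purposes: minimum covers are closed under union, and they grow
    with the family of rows. *)
Lemma cover_cost_submod A B T T' : A \subset B ->
  cover_cost B (T :|: T') + cover_cost A (T :&: T') <=
  cover_cost A T + cover_cost B T'.
Proof.
move=> sAB; rewrite !cover_cost_sum addnACA cardsUI [leqRHS]addnACA leq_add2l.
rewrite -!big_split /=; apply: leq_sum => i _.
have := subsetP sAB i; rewrite subsetI.
have sU (U : {set J}) : N i \subset U -> U \subset T :|: T' -> N i \subset T :|: T'.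
  exact: subset_trans.
move: (sU T) (sU T'); rewrite subsetUl subsetUr.
case: (i \in A); case: (i \in B); case: (N i \subset T); case: (N i \subset T');
  case: (N i \subset T :|: T') => //=; do ?[by move=> /(_ isT)];
  by [move=> /(_ isT isT) | move=> _ /(_ isT isT) | move=> _ _ /(_ isT)].
Qed.

Lemma min_coverU A B T T' : A \subset B -> min_cover A T -> min_cover B T' ->
  min_cover B (T :|: T').
Proof.
move=> sAB /eqP mT /eqP mT'; rewrite min_coverE.
have := cover_cost_submod T T' sAB; rewrite mT mT' => le_sum.
have := leq_trans (leq_add (leqnn _) (cover_num_le A (T :&: T'))) le_sum.
by rewrite addnC leq_add2l.
Qed.

Lemma min_cover_closure A : min_cover A (cover_closure A).
Proof.
have [T mT] := min_coverP A.
have /setUidPr <- : T \subset cover_closure A by apply: bigcup_sup mT.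
rewrite /cover_closure; elim/big_rec: _ => [|U V mU mV]; first by rewrite setU0.
by rewrite setUCA; apply: min_coverU mU mV.
Qed.

Lemma min_cover_sub A T : min_cover A T -> T \subset cover_closure A.
Proof. by move=> mT; apply: bigcup_sup mT. Qed.

Lemma cover_closure_mono A B : A \subset B ->
  cover_closure A \subset cover_closure B.
Proof.
move=> sAB; apply: subset_trans (subsetUl _ (cover_closure B)) _.
by apply: min_cover_sub; apply: min_coverU sAB _ _; apply: min_cover_closure.
Qed.

Lemma cover_costU1 A i T :
  cover_cost (i |: A) T <= cover_cost A T + ~~ (N i \subset T).
Proof.
rewrite -addnA leq_add2l; case: (boolP (N i \subset T)) => Ni; rewrite ?addn0 ?addn1.
  apply: subset_leq_card; apply/subsetP => j; rewrite !inE => /andP[].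
  by case: eqP => [->|_ /= ->]; [rewrite Ni | move=> ->].
apply: leq_trans (subset_leq_card (B := i |: [set j in A | ~~ (N j \subset T)]) _) _.
  by apply/subsetP => j; rewrite !inE => /andP[/orP[->|->] ->]; rewrite ?orbT.
by rewrite cardsU1; case: (i \notin _).
Qed.

(** The largest minimum cover still covers i |: A when it contains N i. *)
Lemma cover_numU1 A i :
  cover_num (i |: A) <= cover_num A + ~~ (N i \subset cover_closure A).
Proof.
apply: leq_trans (cover_num_le _ (cover_closure A)) _.
by rewrite -(eqP (min_cover_closure A)) cover_costU1.
Qed.

(** If the unit row i were free, a minimum cover of i |: A would also be a minimum
    cover of A, so j, lying outside the closure, would not belong to it and the
    row i would be paid for. *)
Lemma cover_numU1_unit A i j : N i = [set j] ->
  cover_num A + (j \notin cover_closure A) <= cover_num (i |: A).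
Proof.
move=> Ni; case: (boolP (j \in cover_closure A)) => [_|jA].
  by rewrite addn0 cover_num_mono // subsetUr.
rewrite addn1 ltnNge; apply/negP => le_num.
have [T mT] := min_coverP (i |: A).
have leAT : cover_cost A T <= cover_cost (i |: A) T.
  by rewrite cover_cost_mono // subsetUr.
have mAT : min_cover A T.
  by rewrite min_coverE (leq_trans leAT) // (eqP mT).
have jT : j \notin T by apply: contra jA; apply/subsetP/min_cover_sub.
have iA : i \notin A.
  apply: contra jA => iA; apply: (subsetP (min_cover_sub (T := j |: T) _)).
    rewrite min_coverE -(eqP mAT) /cover_cost cardsU1 jT add1n addSn.
    apply: (leq_trans _ (_ : #|T| + #|i |: [set k in A | ~~ (N k \subset j |: T)]| <= _)).
      by rewrite -addnS leq_add2l cardsU1 !inE iA Ni sub1set !inE eqxx.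
    rewrite leq_add2l; apply: subset_leq_card; apply/subsetP => k.
    rewrite !inE => /orP[/eqP ->|/andP[-> nk]]; first by rewrite iA Ni sub1set.
    by apply: contra nk => /subset_trans; apply; apply: subsetUr.
  by rewrite !inE eqxx.
have : cover_cost (i |: A) T = (cover_cost A T).+1.
  rewrite /cover_cost -addnS; congr (_ + _).
  have -> : [set k in i |: A | ~~ (N k \subset T)] =
      i |: [set k in A | ~~ (N k \subset T)].
    apply/setP => k; rewrite !inE; case: eqP => [->|] //=.
    by rewrite Ni sub1set jT.
  by rewrite cardsU1 !inE (negPf iA).
rewrite (eqP mT) (eqP mAT) => eq_num; move: le_num.
by rewrite eq_num ltnn.
Qed.

Lemma cover_num_card A : cover_num A <= #|A|.
Proof.
apply: leq_trans (cover_num_le _ set0) _; rewrite /cover_cost cards0.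
by apply: subset_leq_card; apply/subsetP => i; rewrite inE => /andP[].
Qed.

End Cover.

Section CoverSymmetry.
Variables (I J : finType) (N : I -> {set J}).
Variables (f : I -> I) (g : J -> J).
Hypotheses (f_inj : injective f) (g_inj : injective g).
Hypothesis fgN : forall i, N (f i) = g @: N i.

Lemma imset_bij (K : finType) (h : K -> K) : injective h ->
  bijective (fun T : {set K} => h @: T).
Proof. by move=> h_inj; apply: injF_bij; apply: imset_inj. Qed.

Lemma sub_imset (T T' : {set J}) : (g @: T \subset g @: T') = (T \subset T').
Proof.
apply/idP/idP; last exact: imsetS.
by move=> /subsetP sT; apply/subsetP => x xT; rewrite -(mem_imset _ _ g_inj) sT ?imset_f.
Qed.

Implicit Types (A : {set I}) (T : {set J}).

Lemma cover_cost_imset A T : cover_cost N (f @: A) (g @: T) = cover_cost N A T.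
Proof.
rewrite /cover_cost card_imset //; congr (_ + _).
rewrite -[RHS](card_imset _ f_inj); apply: eq_card => i; rewrite inE.
apply/andP/imsetP => [[/imsetP[k kA ->]]|[k]].
  by rewrite fgN sub_imset => nk; exists k; rewrite ?inE ?kA.
by rewrite inE => /andP[kA nk] ->; rewrite imset_f // fgN sub_imset.
Qed.

Lemma cover_num_imset A : cover_num N (f @: A) = cover_num N A.
Proof.
apply/eqP; rewrite eqn_leq; apply/andP; split.
  have [T /eqP <-] := min_coverP N A.
  by rewrite -cover_cost_imset cover_num_le.
have [T /eqP <-] := min_coverP N (f @: A).
have [g' _ gK] := imset_bij g_inj.
by rewrite -[T]gK cover_cost_imset cover_num_le.
Qed.

Lemma cover_closure_imset A j :
  (g j \in cover_closure N (f @: A)) = (j \in cover_closure N A).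
Proof.
apply/bigcupP/bigcupP => -[T mT jT]; last first.
  exists (g @: T); last exact: imset_f.
  by rewrite /min_cover cover_cost_imset cover_num_imset.
have [g' _ gK] := imset_bij g_inj.
exists (g' T); last by rewrite -(mem_imset _ _ g_inj) (gK T : g @: g' T = T).
by rewrite /min_cover -cover_cost_imset (gK T : g @: g' T = T) -cover_num_imset.
Qed.
End CoverSymmetry.

(** * Expectation over a random set *)

Local Open Scope ring_scope.

Section Mean.
Variables (R : realType) (I : finType).
Implicit Types (p : I -> R) (S T : {set I}) (f g : {set I} -> R).

(** The expectation of f at a random subset of S that contains each i in S
    independently with probability p i. *)
Definition mean p S f : R :=
  \sum_(T in powerset S) f T * \prod_(i in S) (if i \in T then p i else 1 - p i).

Lemma mean_set0 p f : mean p set0 f = f set0.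
Proof.
by rewrite /mean powerset0 (big_pred1 set0) ?big_set0 ?mulr1 // => T; rewrite inE.
Qed.

Lemma mean_setU1 p S f i : i \notin S ->
  mean p (i |: S) f =
  p i * mean p S (fun T => f (i |: T)) + (1 - p i) * mean p S f.
Proof.
move=> iS; rewrite /mean (bigID (fun T : {set I} => i \in T)) /=; congr (_ + _).
  rewrite (reindex_onto (fun T => i |: T) (fun T => T :\ i)) /=; last first.
    by move=> T /andP[_ iT]; rewrite setD1K.
  rewrite big_distrr /=; apply: eq_big => [T|T].
    rewrite setU11 andbT !powersetE.
    case: (boolP (i \in T)) => iT.
      suff -> : T \subset S = false.
        by apply/andP => -[_ /eqP E]; move: iT; rewrite -E !inE eqxx.
      by apply/negP => /subsetP /(_ _ iT); rewrite (negPf iS).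
    rewrite setU1K // eqxx andbT subUset sub1set setU11 /=.
    by rewrite -[in RHS](setU1K iS) subsetD1 iT andbT.
  move=> /andP[_ /eqP TE]; rewrite big_setU1 //= setU11 mulrCA; congr (_ * (_ * _)).
  apply: eq_bigr => j jS; rewrite !inE; case: eqP => // ji.
  by move: iS; rewrite -ji jS.
rewrite big_distrr /=; apply: eq_big => [T|T].
  by rewrite !powersetE -[in RHS](setU1K iS) subsetD1.
move=> /andP[_ iT]; rewrite big_setU1 //= (negPf iT) mulrCA; congr (_ * (_ * _)).
Qed.

Lemma eq_mean p S f g : (forall T, T \subset S -> f T = g T) ->
  mean p S f = mean p S g.
Proof. by move=> fg; apply: eq_bigr => T; rewrite powersetE => /fg ->. Qed.

Lemma meanD p S f g : mean p S (fun T => f T + g T) = mean p S f + mean p S g.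
Proof. by rewrite -big_split /=; apply: eq_bigr => T _; rewrite mulrDl. Qed.

Lemma meanZ p S a f : mean p S (fun T => a * f T) = a * mean p S f.
Proof. by rewrite big_distrr /=; apply: eq_bigr => T _; rewrite mulrA. Qed.

Lemma meanB p S f g : mean p S (fun T => f T - g T) = mean p S f - mean p S g.
Proof.
rewrite -[- mean p S g]mulN1r -meanZ -meanD; apply: eq_mean => T _.
by rewrite mulN1r.
Qed.

Lemma mean_cst p S a : mean p S (fun=> a) = a.
Proof.
elim/subset_ind: S => [|i S iS IH]; first by rewrite mean_set0.
by rewrite mean_setU1 // !IH; ring.
Qed.

Lemma mean_card p S : mean p S (fun T => #|T|%:R) = \sum_(i in S) p i.
Proof.
elim/subset_ind: S => [|i S iS IH]; first by rewrite mean_set0 cards0 big_set0.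
rewrite mean_setU1 // big_setU1 //= IH.
rewrite (@eq_mean _ _ _ (fun T => 1 + #|T|%:R)) => [|T TS]; last first.
  by rewrite cardsU1 natrD (contra _ iS) // => /(subsetP TS).
by rewrite meanD mean_cst IH; ring.
Qed.

Lemma mean_imset p S f (h : I -> I) : injective h -> h @: S = S ->
  (forall i, p (h i) = p i) -> mean p S (fun T => f (h @: T)) = mean p S f.
Proof.
move=> h_inj hS hp; have [k kK hK] := imset_bij h_inj.
rewrite /mean [RHS](reindex (fun T : {set I} => h @: T)) /=; last by exists k => T _.
apply: eq_big => [T|T _]; first by rewrite !powersetE -{2}hS sub_imset.
congr (_ * _); rewrite -{2}hS big_imset /=; last by move=> x y _ _; apply: h_inj.
by apply: eq_bigr => i _; rewrite hp mem_imset.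
Qed.

Section Probability.
Variable p : I -> R.
Hypothesis p01 : forall i, 0 <= p i <= 1.

Let p0 i : 0 <= p i. Proof. by case/andP: (p01 i). Qed.
Let q0 i : 0 <= 1 - p i. Proof. by rewrite subr_ge0; case/andP: (p01 i). Qed.

Lemma ler_mean S f g : (forall T, T \subset S -> f T <= g T) ->
  mean p S f <= mean p S g.
Proof.
move=> fg; apply: ler_sum => T; rewrite powersetE => /fg le_fg.
by apply: ler_wpM2r le_fg; apply: prodr_ge0 => i _; case: ifP.
Qed.

Lemma mean_ge0 S f : (forall T, 0 <= f T) -> 0 <= mean p S f.
Proof. by move=> f0; rewrite -(mean_cst p S 0); apply: ler_mean. Qed.

Definition increasing f := forall T T' : {set I}, T \subset T' -> f T <= f T'.

Lemma increasing_setU1 i f : increasing f -> increasing (fun T => f (i |: T)).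
Proof. by move=> incf T T' sT; apply: incf; apply: setUS. Qed.

(** Harris's inequality.  Conditioning on whether i belongs to the set orders the
    two conditional means of f in the same way as those of g, so averaging over i
    adds a nonnegative covariance. *)
Lemma mean_harris S f g : increasing f -> increasing g ->
  mean p S f * mean p S g <= mean p S (fun T => f T * g T).
Proof.
elim/subset_ind: S f g => [|i S iS IH] f g incf incg.
  by rewrite !mean_set0.
rewrite !mean_setU1 //.
set f1 := mean p S (fun T => f (i |: T)); set f0 := mean p S f.
set g1 := mean p S (fun T => g (i |: T)); set g0 := mean p S g.
have f01 : 0 <= f1 - f0.
  by rewrite subr_ge0; apply: ler_mean => T _; apply/incf/subsetUr.
have g01 : 0 <= g1 - g0.
  by rewrite subr_ge0; apply: ler_mean => T _; apply/incg/subsetUr.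
have IH1 := IH _ _ (increasing_setU1 i incf) (increasing_setU1 i incg).
have IH0 := IH _ _ incf incg.
apply: le_trans (lerD (ler_wpM2l (p0 i) IH1) (ler_wpM2l (q0 i) IH0)).
rewrite -/f1 -/f0 -/g1 -/g0 -subr_ge0.
set X := (X in 0 <= X).
suff -> : X = p i * (1 - p i) * ((f1 - f0) * (g1 - g0)).
  by rewrite !mulr_ge0.
by rewrite /X; ring.
Qed.

Lemma mean_harris_prod S (K : finType) (A : {set K}) (F : K -> {set I} -> R) :
  (forall k T, 0 <= F k T) -> (forall k, increasing (F k)) ->
  \prod_(k in A) mean p S (F k) <= mean p S (fun T => \prod_(k in A) F k T).
Proof.
move=> F0 incF; elim/subset_ind: A => [|k A kA IH].
  rewrite big_set0 (@eq_mean _ _ _ (fun=> 1)) ?mean_cst // => T _.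
  by rewrite big_set0.
rewrite big_setU1 //=.
rewrite [leRHS](@eq_mean _ _ _ (fun T => F k T * \prod_(k in A) F k T)) => [|T _]; last first.
  by rewrite /= big_setU1.
apply: le_trans (mean_harris _ (incF k) _).
  by apply: ler_wpM2l IH; apply: mean_ge0.
by move=> T T' sT; apply: ler_prod => j _; rewrite F0 incF.
Qed.

Definition lipschitz1 f := forall i T, `|f (i |: T) - f T| <= 1.

(** The Efron-Stein bound: the element i contributes p (1 - p) times the square of
    the difference of two conditional means, a difference of at most 1. *)
Lemma mean_variance S f : lipschitz1 f ->
  mean p S (fun T => f T ^+ 2) - mean p S f ^+ 2 <= \sum_(i in S) p i.
Proof.
elim/subset_ind: S f => [|i S iS IH] f lipf.
  by rewrite !mean_set0 big_set0 subrr.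
rewrite !mean_setU1 // big_setU1 //=.
have lipf1 : lipschitz1 (fun T => f (i |: T)).
  by move=> j T; rewrite /= setUCA; apply: lipf.
have := IH _ lipf1; have := IH _ lipf.
set f1 := mean p S (fun T => f (i |: T)); set f0 := mean p S f.
set v1 := mean p S (fun T => f (i |: T) ^+ 2); set v0 := mean p S (fun T => f T ^+ 2).
set s := \sum_(j in S) p j.
move=> v0s v1s.
have f01 : -1 <= f1 - f0 <= 1.
  rewrite /f1 /f0 -meanB; apply/andP; split.
    rewrite -[leLHS](mean_cst p S); apply: ler_mean => T _.
    by have := lipf i T; rewrite ler_norml => /andP[].
  rewrite -[leRHS](mean_cst p S); apply: ler_mean => T _.
  by have := lipf i T; rewrite ler_norml => /andP[].
have f01sqr : (f1 - f0) ^+ 2 <= 1 by case/andP: f01 => *; nra.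
have := ler_wpM2l (p0 i) v1s; have := ler_wpM2l (q0 i) v0s.
have := ler_wpM2l (mulr_ge0 (p0 i) (q0 i)) f01sqr; have := sqr_ge0 (p i).
by move: (p i) => pi; lra.
Qed.

(** Where f is nonpositive, it differs from its mean by at least the mean. *)
Lemma mean_chebyshev S f : lipschitz1 f -> 0 < mean p S f ->
  mean p S (fun T => (f T <= 0)%R%:R) <= (\sum_(i in S) p i) / mean p S f ^+ 2.
Proof.
move=> lipf; set m := mean p S f => m0.
rewrite ler_pdivlMr ?exprn_gt0 // mulrC; apply: le_trans (mean_variance S lipf).
rewrite -/m -meanZ.
have -> : mean p S (fun T => f T ^+ 2) - m ^+ 2 = mean p S (fun T => (f T - m) ^+ 2).
  rewrite [RHS](@eq_mean _ _ _ (fun T => f T ^+ 2 + (- (m *+ 2) * f T + m ^+ 2))).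
    by rewrite !meanD meanZ mean_cst -/m; ring.
  by move=> T _; ring.
apply: ler_mean => T _; case: (leP (f T) 0) => fT; last by rewrite mulr0n mulr0 sqr_ge0.
by rewrite mulr1n mulr1; nra.
Qed.
End Probability.

Section Russo.
Variables (t : I -> R -> R) (dt : I -> R) (x : R).
Hypothesis t_dt : forall i, is_derive x 1 (t i) (dt i).

(** The probability that a Poisson variable of mean t i y is positive.  With this
    parametrisation the derivative of a mean compares f (i |: T) with f T for the
    full random set T, and not for T deprived of i. *)
Definition poisson_rate (y : R) (i : I) : R := 1 - expR (- t i y).

(** Russo's formula in exponential coordinates: raising t i at unit rate is the
    same as adding i at unit rate to the random set, whether or not it is there. *)
Lemma mean_russo S f :
  is_derive x 1 (fun y => mean (poisson_rate y) S f)
    (\sum_(i in S) dt i * mean (poisson_rate x) S (fun T => f (i |: T) - f T)).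
Proof.
elim/subset_ind: S f => [|i S iS IH] f.
  rewrite big_set0 [X in is_derive _ _ X](_ : _ = cst (f set0)) //.
    exact: is_derive_cst.
  by apply/funext => y; rewrite mean_set0.
pose M g y := mean (poisson_rate y) S g.
have dM g : is_derive x 1 (M g) _ := IH g.
have dE : is_derive x 1 (fun y => expR (- t i y)) (- dt i * expR (- t i x)).
  apply: (is_derive_eq (is_derive1_comp (is_derive_expR _) (is_deriveN (t_dt i)))).
  by rewrite mulrC.
rewrite [X in is_derive _ _ X](_ : _ = (fun y =>
  M (fun T => f (i |: T)) y + expR (- t i y) * (M f y - M (fun T => f (i |: T)) y)));
  last first.
  by apply/funext => y; rewrite mean_setU1 // /M /poisson_rate; ring.
apply: (is_derive_eq (is_deriveD (dM _) (is_deriveM dE (is_deriveB (dM _) (dM _))))).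
rewrite big_setU1 //= mean_setU1 //.
rewrite [X in poisson_rate x i * X](_ : _ = 0); last first.
  by rewrite -(mean_cst (poisson_rate x) S 0); apply: eq_mean => T _; rewrite setUA setUid subrr.
have -> : \sum_(j in S) dt j * mean (poisson_rate x) (i |: S)
      (fun T => f (j |: T) - f T) =
    poisson_rate x i * (\sum_(j in S) dt j * mean (poisson_rate x) S
      (fun T => f (i |: (j |: T)) - f (i |: T))) +
    (1 - poisson_rate x i) * (\sum_(j in S) dt j * mean (poisson_rate x) S
      (fun T => f (j |: T) - f T)).
  rewrite !big_distrr -big_split; apply: eq_bigr => j _ /=.
  rewrite mean_setU1 //.
  rewrite (@eq_mean _ _ (fun T => f (j |: (i |: T)) - _)
    (fun T => f (i |: (j |: T)) - f (i |: T))) => [|T _]; last by rewrite setUCA.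
  by ring.
rewrite meanB.
set A := \sum_(j in S) _ * mean _ _ (fun T => f (i |: _) - _).
set B := \sum_(j in S) _ * mean _ _ (fun T => f (j |: T) - _).
rewrite /GRing.scale /= !fctE /M /poisson_rate; ring.
Qed.
End Russo.
End Mean.

Section MeanSupport.
Variables (R : realType) (I : finType).
Implicit Types (p : I -> R) (S T : {set I}) (f : {set I} -> R).

Lemma eq_mean_prob p p' S f : {in S, p =1 p'} -> mean p S f = mean p' S f.
Proof.
move=> pp'; apply: eq_bigr => T _; congr (_ * _); apply: eq_bigr => i iS.
by rewrite pp'.
Qed.

Lemma mean_support p S S' f : S \subset S' ->
  (forall i, i \in S' -> i \notin S -> p i = 0) -> mean p S' f = mean p S f.
Proof.
move=> sS p0; rewrite -(setID S' S) (setIidPr sS) setUC.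
have {p0} : forall i, i \in S' :\: S -> (i \notin S) /\ p i = 0.
  by move=> i; rewrite inE => /andP[iS iS']; split=> //; apply: p0.
elim/subset_ind: (S' :\: S) => [|i D iD IH] p0; first by rewrite set0U.
have [iS pi0] := p0 i (setU11 _ _).
rewrite -setUA mean_setU1 ?inE ?negb_or ?iD // pi0 mul0r add0r subr0 mul1r.
by apply: IH => j jD; apply: p0; rewrite setU1r.
Qed.
End MeanSupport.

(** * From covers to cycles *)

Lemma ffun_kernel (F : fieldType) (I K : finType)
    (f : {linear {ffun I -> F^o} -> {ffun K -> F^o}}) :
  (#|K| < #|I|)%N -> exists2 z, z != 0 & f z = 0.
Proof.
move=> ltKI; pose g := linfun f.
have [/eqP ker0|nz] := boolP (lker g == 0%VS); last first.
  exists (vpick (lker g)); first by rewrite vpick0.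
  by apply/eqP; rewrite -(lfunE f) -memv_ker memv_pick.
have := limg_ker_dim g fullv.
rewrite ker0 capv0 dimv0 add0n => dim_eq.
have := dimvS (subvf (limg g)); rewrite dim_eq !dimvf.
have dimE (L : finType) : dim {ffun L -> F^o} = #|L| by exact: muln1.
by rewrite !dimE leqNgt ltKI.
Qed.

Section Homology.
Variables (F : fieldType) (n k : nat) (X : {set {set 'I_n}}).

(** The complex has no face of dimension k + 2, so that every (k+1)-boundary
    vanishes. *)
Lemma homology_cycle (z : chain F X k.+1) : 
  (forall s, s \in X -> #|s| != k.+3) -> boundary z = 0 -> z != 0 ->
  exists h : homology F X k.+1, h != 0.
Proof.
move=> no_face bz nz.
have z_cycle : z \in cycles F X k.+1.
  by rewrite memv_ker lfunE /= bz.
have [y zy] : exists y : subvs_of (cycles F X k.+1), vsval y = z.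
  by exists (vsproj _ z); rewrite vsprojK.
exists (\pi_(Quotient.quot _) y)%qT.
rewrite -[0](raddf0 \pi_(Quotient.quot (boundaries_in_cycles F X k.+1))%qT).
rewrite -Quotient.idealrBE subr0.
apply: contra nz => /=; rewrite -memv_preim lfunE /= zy => /memv_imgP[c _ ->].
rewrite lfunE /=; apply/eqP/ffunP => t; rewrite !ffunE big1 // => s _.
by have := valP s => /andP[/no_face/negP nf /nf].
Qed.

Definition facets (s : {set 'I_n}) : {set {set 'I_n}} := [set s :\ v | v in s].

(** A chain that vanishes on the faces with a facet outside T has no boundary
    outside T.  It is a cycle if its boundary also vanishes on T, and these are
    fewer linear conditions than there are faces. *)
Lemma homology_of_cover (T : {set {set 'I_n}}) :
    (forall s, s \in X -> #|s| != k.+3) ->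
    (#|T| + #|[set s in X | (#|s| == k.+2) && ~~ (facets s \subset T)]| <
      #|[set s in X | #|s| == k.+2]|)%N ->
  exists h : homology F X k.+1, h != 0.
Proof.
move=> no_face lt_card.
pose U := [set s in X | (#|s| == k.+2) && ~~ (facets s \subset T)].
pose K : finType := ({t | t \in T} + {s | s \in U})%type.
pose f (z : {ffun face X k.+1 -> F^o}) : {ffun K -> F^o} := [ffun x : K =>
  match x with
  | inl t => \sum_(s : face X k.+1) incidence F (val s) (val t) * z s
  | inr s => \sum_(s' : face X k.+1 | val s' == val s) z s'
  end].
have f_lin : linear f.
  move=> a x y; apply/ffunP => -[t|s]; rewrite !ffunE /= scaler_sumr -big_split /=.
    by apply: eq_bigr => s _; rewrite !ffunE mulrDr mulrCA.
  by apply: eq_bigr => s' _; rewrite !ffunE.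
pose fl := HB.pack_for {linear {ffun face X k.+1 -> F^o} -> {ffun K -> F^o}} f
  (GRing.isLinear.Build _ _ _ _ f f_lin).
have [|z nz /ffunP fz] := @ffun_kernel _ _ _ fl.
  rewrite card_sum !card_sig; apply: leq_trans lt_card _.
  by rewrite leq_eqVlt; apply/orP; left; apply/eqP/eq_card => s; rewrite !inE.
apply: (homology_cycle no_face _ nz).
have zU s : ~~ (facets (val s) \subset T) -> z s = 0.
  move=> bad; have sU : val s \in U by rewrite inE bad andbT; apply: valP s.
  have := fz (inr (Sub (val s) sU)); rewrite !ffunE (big_pred1 s) //.
apply/ffunP => t; rewrite !ffunE.
have [tT|tT] := boolP (val t \in T).
  by have := fz (inl (Sub (val t) tT)); rewrite !ffunE.
rewrite big1 // => s _.
have [sT|/zU ->] := boolP (facets (val s) \subset T); last by rewrite mulr0.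
rewrite /incidence big1 ?mul0r // => v /andP[vs /eqP st].
by case/negP: tT; rewrite -st; apply: (subsetP sT); apply: imset_f.
Qed.
End Homology.

(** * Interpolation between faces and unit rows *)

Section Interpolation.
Variables (R : realType) (n d : nat).
Implicit Types (s : {set 'I_n}) (Y : {set {set 'I_n}}).

(** A (d-1)-face s indexes both a column and the unit row of that column; a d-face
    indexes a row of the boundary matrix. *)
Definition columns s : {set {set 'I_n}} :=
  if #|s| == d then [set s] else facets s.

Definition rows : {set {set 'I_n}} :=
  [set s : {set 'I_n} | (#|s| == d) || (#|s| == d.+1)].

Lemma columns_ridge s : #|s| = d -> columns s = [set s].
Proof. by rewrite /columns => ->; rewrite eqxx. Qed.

Lemma columns_face s : #|s| = d.+1 -> columns s = facets s.
Proof. by rewrite /columns => ->; rewrite eqn_leq ltnn. Qed.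

Lemma card_facets s : #|facets s| = #|s|.
Proof.
rewrite card_in_imset // => u v us vs /setP /(_ u).
by rewrite !inE eqxx us /=; case: eqP.
Qed.

Lemma facet_card s t : #|s| = d.+1 -> t \in facets s -> #|t| = d.
Proof. by move=> sd /imsetP[v vs ->]; move: sd; rewrite (cardsD1 v) vs => -[]. Qed.

Section Permutation.
Variable pi : {perm 'I_n}.
Let h s : {set 'I_n} := [set pi v | v in s].

Lemma imset_perm_inj : injective h. Proof. exact: imset_inj perm_inj. Qed.

Lemma columns_perm s : columns (h s) = h @: columns s.
Proof.
rewrite /columns card_imset; last exact: perm_inj.
case: ifP => _; first by rewrite imset_set1.
rewrite /facets -!imset_comp; apply: eq_imset => v /=.
apply/setP => u; rewrite -(permKV pi u) !inE !mem_imset ?inE; try exact: perm_inj.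
by rewrite (inj_eq perm_inj).
Qed.

Lemma rows_perm : h @: rows = rows.
Proof.
apply/eqP; rewrite eqEcard card_imset ?leqnn ?andbT; last exact: imset_perm_inj.
apply/subsetP => _ /imsetP[s sr ->]; move: sr; rewrite !inE card_imset //.
exact: perm_inj.
Qed.
End Permutation.

(** The convex function r ^ (k + 1) lies above its tangent at b. *)
Lemma binomial_tangent (r b : R) (k : nat) : 0 <= r -> 0 <= b ->
  k.+1%:R * b ^+ k * r <= r ^+ k.+1 + k%:R * b ^+ k.+1.
Proof.
move=> r0 b0; elim: k => [|k IH]; first by rewrite expr0 expr1; lra.
have := ler_wpM2l r0 IH; have := mulr_ge0 (exprn_ge0 k b0) (sqr_ge0 (r - b)).
move/(ler_wpM2l (ler0n R k.+1)).
rewrite -subr_ge0 => h1; rewrite -subr_ge0 => h2; rewrite -subr_ge0.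
apply: le_trans (addr_ge0 h1 h2) _; rewrite le_eqVlt; apply/orP; left; apply/eqP.
rewrite !exprS -!natr1; ring.
Qed.

Definition cover_size Y : R := (cover_num columns Y)%:R.

Definition frozen s Y : R := (s \in cover_closure columns Y)%:R.

Lemma frozen_ge0 s Y : 0 <= frozen s Y. Proof. exact: ler0n. Qed.

Lemma frozen_increasing s : increasing (frozen s).
Proof.
move=> Y Y' sY; rewrite ler_nat; have := subsetP (cover_closure_mono columns sY) s.
by case: (s \in _) => // ->.
Qed.

(** If all the facets of s are frozen, their union is inside a single minimum
    cover, which therefore covers s at no cost. *)
Lemma cover_setU1_face s Y : #|s| = d.+1 ->
  cover_size (s |: Y) - cover_size Y <= 1 - \prod_(t in facets s) frozen t Y.
Proof.
move=> sd; rewrite lerBlDl.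
have := cover_numU1 columns Y s; rewrite (columns_face sd).
have [sub|nsub] := boolP (facets s \subset _).
  rewrite addn0 big1 ?subrr ?addr0 ?ler_nat // => t ts.
  by rewrite /frozen (subsetP sub).
have [t ts tY] := subsetPn nsub.
rewrite (bigD1 t) //= /frozen (negPf tY) mul0r subr0.
by rewrite /cover_size natr1 ler_nat addn1.
Qed.

Lemma cover_setU1_ridge s Y : #|s| = d -> 1 - frozen s Y <= cover_size (s |: Y) - cover_size Y.
Proof.
move=> sd; have := cover_numU1_unit Y (columns_ridge sd).
rewrite -(ler_nat R) natrD lerBrDl; apply: le_trans.
by rewrite lerD2l /frozen; case: (s \in _); rewrite ?subrr ?subr0.
Qed.

Section SymmetricMeasure.
Variable p : {set 'I_n} -> R.
Hypothesis p01 : forall s, 0 <= p s <= 1.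
Hypothesis p_card : forall s s', #|s| = #|s'| -> p s = p s'.

Lemma mean_frozen_perm (pi : {perm 'I_n}) s :
  mean p rows (frozen [set pi v | v in s]) = mean p rows (frozen s).
Proof.
rewrite -(mean_imset _ (@imset_perm_inj pi) (rows_perm pi)) => [|u]; last first.
  by apply: p_card; rewrite card_imset //; exact: perm_inj.
apply: eq_mean => Y _; congr (_ %:R).
by rewrite (cover_closure_imset (@imset_perm_inj pi) (@imset_perm_inj pi) (columns_perm pi)).
Qed.

(** The permutations of the vertices act transitively on the sets of a given size;
    a transposition of u in s minus s' with v in s' minus s brings s nearer s'. *)
Lemma mean_frozen_card s s' : #|s| = #|s'| ->
  mean p rows (frozen s) = mean p rows (frozen s').
Proof.
have [m] := ubnP #|s :\: s'|; elim: m s => // m IH s ltm eqc.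
have [ss'|/subsetPn[u us us']] := boolP (s \subset s').
  by have /eqP -> : s == s' by rewrite eqEcard ss' eqc leqnn.
have [|v vs' vs] := subsetPn (_ : ~~ (s' \subset s)).
  apply/negP => s's; have /eqP E : s' == s by rewrite eqEcard s's eqc leqnn.
  by rewrite E us in us'.
rewrite -(mean_frozen_perm (tperm u v)); apply: IH; last first.
  by rewrite card_imset //; exact: perm_inj.
suff: [set tperm u v x | x in s] :\: s' \subset (s :\: s') :\ u.
  move=> /subset_leq_card /leq_ltn_trans; apply.
  by move: ltm; rewrite (cardsD1 u (s :\: s')) !inE us us'.
apply/subsetP => x; rewrite 3!inE => /andP[xs' /imsetP[y ys xE]].
move: xs' ys; rewrite xE; case: tpermP => [->|->|/eqP yu /eqP yv].
- by rewrite vs'.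
- by rewrite (negPf vs).
- by move=> ys' ys; rewrite !inE yu ys' ys.
Qed.

(** Harris's inequality for the d + 1 increasing events that the facets are
    frozen. *)
Lemma mean_cover_face s r : #|s| = d.+1 ->
    (forall t : {set 'I_n}, #|t| = d -> mean p rows (frozen t) = r) ->
  mean p rows (fun Y => cover_size (s |: Y) - cover_size Y) <= 1 - r ^+ d.+1.
Proof.
move=> sd rE.
apply: le_trans (ler_mean p01 (fun Y _ => cover_setU1_face Y sd)) _.
rewrite meanB mean_cst lerD2l lerN2.
have := @mean_harris_prod _ _ _ p01 rows _ (facets s) frozen frozen_ge0 frozen_increasing.
apply: le_trans; rewrite (eq_bigr (fun=> r)) => [|t /(facet_card sd)/rE //].
by rewrite prodr_const card_facets sd.
Qed.

Lemma mean_cover_ridge s r : #|s| = d -> mean p rows (frozen s) = r ->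
  1 - r <= mean p rows (fun Y => cover_size (s |: Y) - cover_size Y).
Proof.
move=> sd <-; rewrite -[1](mean_cst p rows) -meanB.
by apply: ler_mean => // Y _; apply: cover_setU1_ridge.
Qed.

End SymmetricMeasure.

(** At time x each face is present with exponent x a and each unit row with exponent
    (1 - x) l.  The choice of l makes the term linear in the probability r of being
    frozen equal to that of the tangent to r ^ (d + 1) at b. *)
Section Path.
Variables (a b : R).
Hypotheses (a0 : 0 <= a) (b0 : 0 <= b).

Let l : R := a * (n - d)%:R * b ^+ d.
Let t s (x : R) : R := if #|s| == d.+1 then x * a else (1 - x) * l.
Let dt s : R := if #|s| == d.+1 then a else - l.
Let Phi x := mean (poisson_rate t x) rows cover_size.
Let dPhi x := \sum_(s in rows) dt s *
  mean (poisson_rate t x) rows (fun Y => cover_size (s |: Y) - cover_size Y).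

Let l0 : 0 <= l. Proof. by rewrite !mulr_ge0 // exprn_ge0. Qed.

Let Phi_derive (x : R) : is_derive x 1 Phi (dPhi x).
Proof.
have did : is_derive x (1 : R) (id : R -> R) 1 := is_derive_id x 1.
have dcst (c : R) : is_derive x (1 : R) (cst c : R -> R) 0 := is_derive_cst c x 1.
apply: mean_russo => s; rewrite /t /dt; case: ifP => _.
  apply: (is_derive_eq (is_deriveM did (dcst a))).
  by rewrite scaler0 add0r /GRing.scale /= mulr1.
apply: (is_derive_eq (is_deriveM (is_deriveB (dcst 1) did) (dcst l))).
by rewrite scaler0 add0r /GRing.scale /= sub0r mulrN1.
Qed.

Let rate01 x s : 0 <= x <= 1 -> 0 <= poisson_rate t x s <= 1.
Proof.
move=> /andP[x0 x1]; rewrite /poisson_rate subr_ge0 gerBl expR_ge0 andbT.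
rewrite expR_le1 oppr_le0 /t; case: ifP => _; apply: mulr_ge0 => //.
by rewrite subr_ge0.
Qed.

Lemma card_sets k : #|[set s : {set 'I_n} | #|s| == k]| = 'C(n, k).
Proof. by rewrite card_draws card_ord. Qed.

Lemma sum_rows (F : {set 'I_n} -> R) :
  \sum_(s in rows) F s =
  \sum_(s : {set 'I_n} | #|s| == d.+1) F s + \sum_(s : {set 'I_n} | #|s| == d) F s.
Proof.
rewrite (bigID (fun s : {set 'I_n} => #|s| == d.+1)) /=; congr (_ + _);
  apply: eq_bigl => s; rewrite inE.
  by case: (#|s| == d.+1); rewrite ?orbT ?andbF.
by case: (#|s| =P d) => [->|_] /=; rewrite ?(eqn_leq d) ?ltnn ?andbF ?andbN.
Qed.

Lemma sumr_card k c : \sum_(s : {set 'I_n} | #|s| == k) c = 'C(n, k)%:R * c :> R.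
Proof. by rewrite mulr_natl -card_sets -sumr_const; apply: eq_bigl => s; rewrite inE. Qed.

(** The common probability r that a ridge is frozen depends on x and is unknown, but
    binomial_tangent removes it from the bound. *)
Let dPhi_le x : 0 <= x <= 1 ->
  dPhi x <= a * 'C(n, d.+1)%:R * (1 - d.+1%:R * b ^+ d + d%:R * b ^+ d.+1).
Proof.
move=> x01; pose p := poisson_rate t x.
have p01 s : 0 <= p s <= 1 by apply: rate01.
have p_card s s' : #|s| = #|s'| -> p s = p s' by rewrite /p /poisson_rate /t => ->.
have [r r0 rE] : exists2 r, 0 <= r &
    forall s, #|s| = d -> mean p rows (frozen s) = r.
  case: (pickP (fun s : {set 'I_n} => #|s| == d)) => [s0 /eqP s0d|none]; last first.
    by exists 0 => // s /eqP; rewrite none.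
  exists (mean p rows (frozen s0)); first by apply: mean_ge0 => // Y; apply: frozen_ge0.
  by move=> s sd; apply: mean_frozen_card; rewrite // sd s0d.
rewrite /dPhi sum_rows.
apply: (@le_trans _ _ ('C(n, d.+1)%:R * (a * (1 - r ^+ d.+1)) +
    'C(n, d)%:R * (- l * (1 - r)))).
  rewrite -!sumr_card; apply: lerD; apply: ler_sum => s /eqP sd; rewrite /dt.
    by rewrite sd eqxx; apply: ler_wpM2l => //; apply: mean_cover_face.
  rewrite sd eqn_leq ltnn andbF !mulNr lerN2; apply: ler_wpM2l => //.
  by apply: mean_cover_ridge => //; apply: rE.
have binE : d.+1%:R * 'C(n, d.+1)%:R = (n - d)%:R * 'C(n, d)%:R :> R.
  by rewrite -!natrM mul_bin_left.
have := binomial_tangent d r0 b0.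
have aM0 : 0 <= a * 'C(n, d.+1)%:R by rewrite mulr_ge0.
move=> /(ler_wpM2l aM0) tang.
have -> : 'C(n, d)%:R * (- l * (1 - r)) =
    - a * b ^+ d * (1 - r) * (d.+1%:R * 'C(n, d.+1)%:R).
  by rewrite binE /l; ring.
by move: tang; set M := 'C(n, d.+1)%:R; rewrite !exprS; lra.
Qed.

(** The mean value theorem along the path.  At its start there are only unit rows,
    and the cover number is at most their number. *)
Lemma mean_cover_le :
  mean (fun s => if #|s| == d.+1 then 1 - expR (- a) else 0) rows cover_size <=
  'C(n, d)%:R * (1 - expR (- (a * (n - d)%:R * b ^+ d))) +
  a * 'C(n, d.+1)%:R * (1 - d.+1%:R * b ^+ d + d%:R * b ^+ d.+1).
Proof.
have -> : mean (fun s => if #|s| == d.+1 then 1 - expR (- a) else 0) rows cover_size = Phi 1.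
  rewrite /Phi; congr (mean _ _ _); apply/funext => s.
  by rewrite /poisson_rate /t; case: ifP => _; rewrite ?mul1r // subrr mul0r oppr0 expR0 subrr.
have Phi0 : Phi 0 <= 'C(n, d)%:R * (1 - expR (- l)).
  have rate0 s : 0 <= poisson_rate t 0 s <= 1 by apply: rate01; rewrite lexx ler01.
  apply: le_trans (ler_mean rate0 (g := fun Y => #|Y|%:R) _) _ => [Y _|].
    by rewrite ler_nat cover_num_card.
  rewrite mean_card sum_rows big1 ?add0r => [|s sd]; last first.
    by rewrite /poisson_rate /t sd mul0r oppr0 expR0 subrr.
  rewrite -sumr_card; apply: ler_sum => s /eqP sd.
  by rewrite /poisson_rate /t sd eqn_leq ltnn andbF subr0 mul1r.
have [] := @MVT R Phi dPhi 0 1 ltr01.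
- by move=> x _; apply: Phi_derive.
- apply: continuous_subspaceT => x.
  by apply: differentiable_continuous; apply/derivable1_diffP; by have := Phi_derive x => -[].
move=> x; rewrite in_itv /= => /andP[/ltW x0 /ltW x1]; rewrite subr0 mulr1 => E.
have := @dPhi_le x; rewrite x0 x1 -E => /(_ isT) => h.
by rewrite -lerBlDl (le_trans _ h) // lerD2l lerN2.
Qed.

End Path.
End Interpolation.

(** * The random complex above the threshold *)

Local Open Scope classical_set_scope.
Local Open Scope ring_scope.

Section RandomComplex.
Variables (R : realType) (n k : nat).
Let d := k.+1.

Lemma prob_XdE (p : R) (E : {set {set 'I_n}} -> Prop) :
  prob_Xd d p E = mean (fun=> p) (top_faces n d)
    (fun T => (`[< E (with_skeleton d T) >])%:R).
Proof.
rewrite /prob_Xd /mean big_mkcondr /=; apply: eq_bigr => T _.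
by case: asbool; rewrite ?mul1r ?mul0r.
Qed.

(** A lower bound for the dimension of the space of cycles. *)
Definition excess (T : {set {set 'I_n}}) : R := #|T|%:R - cover_size R d T.

Lemma excess_lipschitz : lipschitz1 excess.
Proof.
move=> s T; rewrite /excess cardsU1.
have lo : cover_size R d T <= cover_size R d (s |: T) by rewrite ler_nat cover_num_mono ?subsetUr.
have hi : cover_size R d (s |: T) <= cover_size R d T + 1.
  rewrite natr1 ler_nat; apply: leq_trans (cover_numU1 _ _ _) _.
  by rewrite -addn1 leq_add2l leq_b1.
have [b0 b1] : 0 <= (s \notin T)%:R :> R /\ (s \notin T)%:R <= 1 :> R.
  by rewrite ler0n lern1 leq_b1.
by rewrite natrD ler_norml; lra.
Qed.

Lemma homology_of_excess (F : fieldType) (T : {set {set 'I_n}}) : T \subset top_faces n d ->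
  0 < excess T -> exists h : homology F (with_skeleton d T) d, h != 0.
Proof.
move=> sT; have card_T s : s \in T -> #|s| = d.+1.
  by move=> /(subsetP sT); rewrite inE => /eqP.
rewrite /excess subr_gt0 ltr_nat => lt_cover.
have [U /eqP mU] := min_coverP (columns d) T.
have faces s : (s \in with_skeleton d T) && (#|s| == k.+2) = (s \in T).
  rewrite !inE; apply/andP/idP => [[/orP[/andP[_ le_s]|//] /eqP sd]|sT'].
    by rewrite sd ltnn in le_s.
  by rewrite sT' orbT (card_T _ sT').
apply: (@homology_of_cover F n k _ U) => [s|].
  rewrite !inE => /orP[/andP[_ +]|/card_T ->]; last by rewrite /d eqn_leq ltnn andbF.
  by apply: contraTneq => ->; rewrite -ltnNge /d; lia.
have -> : #|[set s in with_skeleton d T | #|s| == k.+2]| = #|T|.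
  by apply: eq_card => s; rewrite inE faces.
apply: leq_ltn_trans lt_cover; rewrite -mU leq_add2l subset_leq_card //.
apply/subsetP => s; rewrite inE andbA faces => /andP[sT' nU].
by rewrite inE sT' columns_face ?card_T.
Qed.

Lemma mean_excess_ge (a b : R) : 0 <= a -> 0 <= b ->
  mean (fun=> 1 - expR (- a)) (top_faces n d) excess >=
  'C(n, d)%:R * (expR (- (a * (n - d)%:R * b ^+ d)) - 1 +
    (n - d)%:R / d.+1%:R * (1 - expR (- a) -
      a * (1 - d.+1%:R * b ^+ d + d%:R * b ^+ d.+1))).
Proof.
move=> a0 b0; set p := 1 - expR (- a).
rewrite meanB mean_card sumr_const.
have card_top : #|top_faces n d| = 'C(n, d.+1) by rewrite card_draws card_ord.
have -> : mean (fun=> p) (top_faces n d) (cover_size R d) =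
    mean (fun s : {set 'I_n} => if #|s| == d.+1 then p else 0) (rows n d) (cover_size R d).
  rewrite (@mean_support _ _ _ (top_faces n d)).
  - by apply: eq_mean_prob => s; rewrite inE => ->.
  - by apply/subsetP => s; rewrite !inE orbC => ->.
  - by move=> s _; rewrite inE => /negPf ->.
have := mean_cover_le n d a0 b0; rewrite -/p card_top.
set m := mean _ _ _.
have binE : 'C(n, d.+1)%:R = (n - d)%:R / d.+1%:R * 'C(n, d)%:R :> R.
  by rewrite mulrAC -natrM -mul_bin_left natrM mulrAC divff ?mul1r // pnatr_eq0.
rewrite -[p *+ _]mulr_natl binE => le_m.
move: le_m; set q := (n - d)%:R / d.+1%:R; set N := 'C(n, d)%:R.
by set e := expR _; lra.
Qed.

(** Chebyshev's inequality for the excess.  Here z is a lower bound for its mean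
    divided by 'C(n, d); the variance is at most the expected number of faces,
    whence a single factor 'C(n, d) in the error. *)
Lemma prob_homology_ge (F : fieldType) (a b : R) : 0 <= a -> 0 <= b ->
  (d <= n)%N ->
  let p := 1 - expR (- a) in
  let z := expR (- (a * (n - d)%:R * b ^+ d)) - 1 + (n - d)%:R / d.+1%:R *
    (p - a * (1 - d.+1%:R * b ^+ d + d%:R * b ^+ d.+1)) in
  0 < z ->
  1 - p * (n - d)%:R / d.+1%:R / ('C(n, d)%:R * z ^+ 2) <=
    prob_Xd d p (fun X : {set {set 'I_n}} => exists h : homology F X d, h != 0) <= 1.
Proof.
move=> a0 b0 dn p z z0.
have p01 (s : {set 'I_n}) : 0 <= p <= 1.
  by rewrite /p subr_ge0 gerBl expR_ge0 andbT expR_le1 oppr_le0.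
have N0 : 0 < 'C(n, d)%:R :> R by rewrite ltr0n bin_gt0.
have le_mean := mean_excess_ge a0 b0; rewrite -/p -/z in le_mean.
have mean0 : 0 < mean (fun=> p) (top_faces n d) excess.
  by apply: lt_le_trans le_mean; rewrite mulr_gt0.
rewrite prob_XdE; apply/andP; split; last first.
  rewrite -[leRHS](mean_cst (fun=> p) (top_faces n d)).
  by apply: ler_mean => // T _; rewrite lern1 leq_b1.
rewrite lerBlDl.
have := mean_chebyshev p01 excess_lipschitz mean0.
set P0 := mean _ _ (fun T => _); set P1 := mean _ _ (fun T => (`[< _ >])%:R) => cheb.
have : 1 <= P0 + P1.
  rewrite -meanD -[leLHS](mean_cst (fun=> p) (top_faces n d)).
  apply: ler_mean => // T sT; have [ex0|ex0] := leP (excess T) 0.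
    by rewrite lerDl ler0n.
  by rewrite mulr0n add0r asboolT //; apply: homology_of_excess sT ex0.
move=> /le_trans; apply; rewrite lerD2r; apply: le_trans cheb _.
rewrite sumr_const card_draws card_ord -[p *+ _]mulr_natl.
have -> : 'C(n, d.+1)%:R = (n - d)%:R / d.+1%:R * 'C(n, d)%:R :> R.
  by rewrite mulrAC -natrM -mul_bin_left natrM mulrAC divff ?mul1r // pnatr_eq0.
have -> : p * (n - d)%:R / d.+1%:R / ('C(n, d)%:R * z ^+ 2) =
    (n - d)%:R / d.+1%:R * 'C(n, d)%:R * p / ('C(n, d)%:R * z) ^+ 2.
  by field; rewrite !gt_eqF //= nat1r.
apply: ler_wpM2l; first by rewrite !mulr_ge0 ?invr_ge0 //; case/andP: (p01 set0).
rewrite lef_pV2 ?posrE ?exprn_gt0 ?mulr_gt0 //.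
by rewrite ler_pXn2r ?nnegrE // ltW // mulr_gt0.
Qed.
End RandomComplex.

Lemma ln_bounds (R : realType) (x : R) : 0 <= x -> x < 1 ->
  x <= - ln (1 - x) <= x / (1 - x).
Proof.
move=> x0 x1; have y0 : 0 < 1 - x by rewrite subr_gt0.
apply/andP; split.
  by rewrite lerNr le_ln1Dx // ltrN2.
rewrite -lnV ?posrE // [X in ln X](_ : _ = 1 + x / (1 - x)); last first.
  by field; rewrite gt_eqF.
by apply: le_ln1Dx; apply: (lt_le_trans (y := 0)); rewrite ?ltrN10 // divr_ge0 // ltW.
Qed.

(** Here p is the probability of a face, a the exponent for which
    p = 1 - expR (- a), and z the normalised lower bound on the mean excess, which
    tends to the positive quantity of excess_gt0. *)
Section Limit.
Variables (R : realType) (F : fieldType) (k : nat) (c b : R).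
Let d := k.+1.
Hypotheses (c0 : 0 < c) (b0 : 0 <= b).
Hypothesis excess_gt0 :
  0 < expR (- (c * b ^+ d)) - 1 + c / d.+1%:R *
    (1 - (1 - d.+1%:R * b ^+ d + d%:R * b ^+ d.+1)).

Let p (n : nat) : R := c / n%:R.
Let a (n : nat) : R := - ln (1 - p n).
Let K : R := 1 - d.+1%:R * b ^+ d + d%:R * b ^+ d.+1.
Let z (n : nat) : R := expR (- (a n * (n - d)%:R * b ^+ d)) - 1 +
  (n - d)%:R / d.+1%:R * (p n - a n * K).

Let invn_cvg0 : (n%:R^-1 : R) @[n --> \oo] --> (0 : R).
Proof.
apply/gtr0_cvgV0; last exact: cvgr_idn.
by exists 1%N => // n /= n0; rewrite ltr0n.
Qed.

Let p_cvg : p n @[n --> \oo] --> (0 : R).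
Proof. by rewrite -[0](mulr0 c); apply: cvgMl_tmp invn_cvg0. Qed.

Let pnd_cvg : p n * (n - d)%:R @[n --> \oo] --> c.
Proof.
suff : c - p n * d%:R @[n --> \oo] --> c - 0 * d%:R.
  rewrite mul0r subr0; apply: cvg_trans; apply: near_eq_cvg.
  near=> n; have dn : (d <= n)%N by near: n; apply: nbhs_infty_ge.
  rewrite /p natrB // mulrBr divfK // pnatr_eq0 -lt0n.
  exact: leq_trans dn.
by apply: cvgB; [exact: cvg_cst | apply: cvgMr_tmp p_cvg].
Unshelve. all: by end_near. Qed.

Let and_cvg : a n * (n - d)%:R @[n --> \oo] --> c.
Proof.
apply: (@squeeze_cvgr _ _ _ _ (fun n => p n * (n - d)%:R)
  (fun n => p n * (n - d)%:R * (1 - p n)^-1)) => //; last first.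
  rewrite -[c in X in _ --> X]mulr1 -[1 in X in _ --> X]invr1.
  apply: cvgM => //; apply: cvgV; first exact: oner_neq0.
  by rewrite -[1 in X in _ --> X]subr0; apply: cvgB; [exact: cvg_cst | exact: p_cvg].
near=> n.
have p1 : p n < 1 by near: n; apply: (cvgr_lt (0:R)).
have p0 : 0 <= p n by rewrite divr_ge0 // ltW.
have /andP[lo hi] := ln_bounds p0 p1.
by rewrite ler_wpM2r //= mulrAC ler_wpM2r.
Unshelve. all: by end_near. Qed.

Let z_cvg : z n @[n --> \oo] --> expR (- (c * b ^+ d)) - 1 + c / d.+1%:R * (1 - K).
Proof.
apply: cvgD.
  apply: cvgB; last exact: cvg_cst.
  apply: (@continuous_cvg _ _ _ _ _ _ expR); first exact: continuous_expR.
  by apply: cvgN; apply: cvgMr_tmp.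
rewrite (_ : (fun n => _) = fun n => (p n * (n - d)%:R - a n * (n - d)%:R * K) / d.+1%:R).
  rewrite (_ : c / d.+1%:R * (1 - K) = (c - c * K) / d.+1%:R); last by ring.
  by apply: cvgMr_tmp; apply: cvgB => //; apply: cvgMr_tmp.
by apply/funext => n; ring.
Qed.

Lemma leq_sub_bin n : (n - d <= 'C(n, d))%N.
Proof.
rewrite /d; elim: n => // n IH; rewrite binS.
case: (leqP k n) => kn; last by rewrite (eqP (_ : n.+1 - k.+1 == 0)%N) // subn_eq0 ltnW.
have : (0 < 'C(n, k))%N by rewrite bin_gt0.
by lia.
Qed.

Lemma prob_homology_cvg :
  prob_Xd d (c / n%:R) (fun X : {set {set 'I_n}} => exists h : homology F X d, h != 0)
    @[n --> \oo] --> (1 : R).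
Proof.
set pr := fun n : nat => prob_Xd _ _ _.
have := excess_gt0; set dl := (X in 0 < X) => dl_gt0.
have err_cvg : p n * (n - d)%:R / d.+1%:R / (z n ^+ 2) * ((n - d)%:R)^-1 @[n --> \oo] --> (0 : R).
  rewrite -[0](mulr0 (c / d.+1%:R / (dl ^+ 2))); apply: cvgM.
    apply: cvgM; first exact: cvgMr_tmp.
    apply: cvgV; first by rewrite expf_neq0 // gt_eqF.
    by apply: cvgM; apply: z_cvg.
  apply/gtr0_cvgV0.
    by exists d.+1 => // n /= dn; rewrite ltr0n subn_gt0.
  apply/cvgryPge => M; near=> n.
  have h : M + d%:R <= n%:R by near: n; apply: nbhs_infty_ger.
  have dn : (d <= n)%N by near: n; apply: nbhs_infty_ge.
  by rewrite natrB // lerBrDr.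
apply: (@squeeze_cvgr _ _ _ _
  (fun n => 1 - p n * (n - d)%:R / d.+1%:R / (z n ^+ 2) * ((n - d)%:R)^-1) (fun=> 1)).
- near=> n.
  have dn : (d < n)%N by near: n; apply: nbhs_infty_gt.
  have p1 : p n < 1 by near: n; apply: (cvgr_lt (0:R)).
  have p0 : 0 <= p n by rewrite divr_ge0 // ltW.
  have z0 : 0 < z n by near: n; apply: (cvgr_gt dl).
  have /andP[a0 _] := ln_bounds p0 p1.
  have pE : 1 - expR (- a n) = p n.
    by rewrite opprK lnK ?posrE ?subr_gt0 //; ring.
  have := @prob_homology_ge R n k F (a n) b (le_trans p0 a0) b0 (ltnW dn).
  rewrite /= pE -/(z n) => /(_ z0) /andP[lo ->]; rewrite andbT.
  apply: le_trans lo; rewrite lerD2l lerN2 invfM mulrA [leLHS]mulrAC.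
  apply: ler_wpM2l.
    by rewrite mulr_ge0 ?invr_ge0 ?exprn_ge0 ?(ltW z0) ?divr_ge0 ?mulr_ge0 // ltW.
  by rewrite lef_pV2 ?posrE ?ltr0n ?subn_gt0 ?bin_gt0 ?(ltnW dn) // ler_nat leq_sub_bin.
- by rewrite -[1 in X in _ --> X]subr0; apply: cvgB => //; exact: cvg_cst.
- exact: cvg_cst.
Unshelve. all: by end_near. Qed.

End Limit.

(** * Taylor bounds for the exponential *)

Section ExpBounds.
Variable R : realType.
Implicit Types z : R.

Lemma le_of_derive_ge0 (f df : R -> R) (x y : R) : x <= y ->
  (forall t, x <= t <= y -> is_derive t 1 f (df t)) ->
  (forall t, x < t < y -> 0 <= df t) -> f x <= f y.
Proof.
rewrite le_eqVlt => /orP[/eqP -> //|xy] fdf df0.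
have [] := @MVT R f df x y xy.
- by move=> t; rewrite in_itv /= => /andP[xt ty]; apply: fdf; rewrite !ltW.
- apply: derivable_within_continuous => t; rewrite in_itv /= => xty.
  by have := fdf t xty => -[].
move=> t; rewrite in_itv /= => xty E; rewrite -subr_ge0 E mulr_ge0 ?df0 //.
by rewrite subr_ge0 ltW.
Qed.

Fixpoint exp_poly (n : nat) z : R :=
  if n is n'.+1 then exp_poly n' z + z ^+ n / n`!%:R else 1.

(** Horner's scheme for the Taylor polynomial keeps every numeral small: no
    factorials occur, which matters when the bounds are evaluated at rationals. *)
Fixpoint exp_horner (n j : nat) z : R :=
  if n is n'.+1 then 1 + z / j%:R * exp_horner n' j.+1 z else 1.

Lemma exp_hornerS n j z : exp_horner n.+1 j.+1 z =
  exp_horner n j.+1 z + z ^+ n.+1 * j`!%:R / (j + n.+1)`!%:R.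
Proof.
have nz i : (i`!%:R : R) != 0 by rewrite pnatr_eq0 -lt0n fact_gt0.
elim: n j => [|n IH] j.
  rewrite /= addn1 factS natrM expr1; field.
  by rewrite nz nat1r pnatr_eq0.
rewrite [LHS]/= -/(exp_horner n.+1 j.+2 z) IH [in RHS]/=.
rewrite [(j.+1)`!]factS natrM (addSnnS j n.+1) [z ^+ n.+2]exprS. field.
by rewrite nz nat1r pnatr_eq0.
Qed.

Lemma exp_polyE n z : exp_poly n z = exp_horner n 1 z.
Proof. by elim: n => // n IH; rewrite exp_hornerS /= IH fact0 mulr1 add0n. Qed.

Lemma is_derive_exp_poly n z :
  is_derive z 1 (exp_poly n) (exp_poly n z - z ^+ n / n`!%:R).
Proof.
elim: n => [|n IH].
  rewrite expr0 fact0 divr1 subrr (_ : exp_poly 0 = cst 1); first exact: is_derive_cst.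
  by apply/funext.
have did : is_derive z (1 : R) (id : R -> R) 1 := is_derive_id z 1.
have dcst (c : R) : is_derive z (1 : R) (cst c : R -> R) 0 := is_derive_cst c z 1.
rewrite [X in is_derive _ _ X](_ : _ = exp_poly n + (id ^+ n.+1) * cst (n.+1`!%:R^-1)).
  apply: (is_derive_eq (is_deriveD IH (is_deriveM (is_deriveX n.+1 did) (dcst n.+1`!%:R^-1)))).
  rewrite scaler0 add0r /GRing.scale /= factS natrM invfM addrK mulr1.
  by rewrite mulrACA mulVf ?pnatr_eq0 // mul1r mulrC subrK.
by apply/funext => t; rewrite fctE exprfctE.
Qed.

Lemma exp_poly0 n : exp_poly n 0 = 1.
Proof. by elim: n => //= n ->; rewrite exprS !mul0r addr0. Qed.

(** The product expR (- z) * exp_poly n z has derivative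
    - expR (- z) * z ^ n / n!, so it decreases from its value 1 at 0. *)
Lemma exp_poly_le n z : 0 <= z -> exp_poly n z <= expR z.
Proof.
move=> z0.
suff : - (expR (- 0) * exp_poly n 0) <= - (expR (- z) * exp_poly n z).
  rewrite oppr0 expR0 exp_poly0 mulr1 lerN2 expRN mulrC ler_pdivrMr ?expR_gt0 //.
  by rewrite mul1r.
pose df (t : R) := expR (- t) * (t ^+ n / n`!%:R).
apply: (@le_of_derive_ge0 (fun t : R => - (expR (- t) * exp_poly n t)) df 0 z) => // t.
  move=> _; have did : is_derive t (1 : R) (id : R -> R) 1 := is_derive_id t 1.
  have dE : is_derive t 1 (fun t => expR (- t)) (- expR (- t)).
    apply: (is_derive_eq (is_derive1_comp (is_derive_expR _) (is_deriveN did))).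
    by rewrite mulrN1.
  apply: (is_derive_eq (is_deriveN (is_deriveM dE (is_derive_exp_poly n t)))).
  by rewrite /GRing.scale /df /=; ring.
by move=> /andP[/ltW t0 _]; rewrite mulr_ge0 ?expR_ge0 ?divr_ge0 ?exprn_ge0.
Qed.

(** With the next Taylor term counted twice, the derivative of the same product
    is a positive multiple of 1 - 2 z / (n + 1), hence nonnegative in this range. *)
Lemma le_exp_poly n z : 0 <= z -> z <= (n.+1%:R) / 2 ->
  expR z <= exp_poly n z + 2 * (z ^+ n.+1 / n.+1`!%:R).
Proof.
move=> z0 zn.
have -> : exp_poly n z + 2 * (z ^+ n.+1 / n.+1`!%:R) = 2 * exp_poly n.+1 z - exp_poly n z.
  by rewrite /=; ring.
suff : expR (- 0) * (2 * exp_poly n.+1 0 - exp_poly n 0) <=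
       expR (- z) * (2 * exp_poly n.+1 z - exp_poly n z).
  rewrite oppr0 expR0 !exp_poly0 mul1r expRN [leRHS]mulrC ler_pdivlMr ?expR_gt0 //.
  by rewrite mulr1 (_ : 2 - 1 = 1 :> R) ?mul1r //; ring.
pose df (t : R) := expR (- t) * (t ^+ n / n`!%:R * (1 - 2 * t / n.+1%:R)).
apply: (@le_of_derive_ge0
  (fun t : R => expR (- t) * (2 * exp_poly n.+1 t - exp_poly n t)) df 0 z) => // t.
  move=> _; have did : is_derive t (1 : R) (id : R -> R) 1 := is_derive_id t 1.
  have dE : is_derive t 1 (fun t => expR (- t)) (- expR (- t)).
    apply: (is_derive_eq (is_derive1_comp (is_derive_expR _) (is_deriveN did))).
    by rewrite mulrN1.
  have d2 : is_derive t (1 : R) (cst 2 : R -> R) 0 := is_derive_cst _ t 1.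
  apply: (is_derive_eq (is_deriveM dE (is_deriveB
    (is_deriveM d2 (is_derive_exp_poly n.+1 t)) (is_derive_exp_poly n t)))).
  rewrite scaler0 addr0 /GRing.scale /= !fctE /= /df.
  rewrite factS natrM exprS; field.
  by rewrite nat1r !pnatr_eq0 -!lt0n fact_gt0.
move=> /andP[/ltW t0 /ltW tz]; rewrite !mulr_ge0 ?expR_ge0 ?invr_ge0 ?exprn_ge0 //.
rewrite subr_ge0 ler_pdivrMr ?ltr0n // mul1r; move: zn.
by rewrite ler_pdivlMr //; lra.
Qed.
End ExpBounds.

(** * The equation defining beta *)

Section Beta.
Variable R : realType.
Implicit Types (u v b : R) (d : nat).

Lemma rolle_zero (f df : R -> R) (x y : R) : x < y ->
  (forall t, x <= t <= y -> is_derive t 1 f (df t)) -> f x = f y ->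
  exists2 t, x < t < y & df t = 0.
Proof.
move=> xy fdf fxy; have [] := @MVT R f df x y xy.
- by move=> t; rewrite in_itv /= => /andP[xt ty]; apply: fdf; rewrite !ltW.
- apply: derivable_within_continuous => t; rewrite in_itv /= => xty.
  by have := fdf t xty => -[].
move=> t; rewrite in_itv /= => xty /esym/eqP E; exists t => //.
by move: E; rewrite fxy subrr mulf_eq0 subr_eq0 [y == x]gt_eqF // orbF => /eqP.
Qed.

(** The defining equation of beta in the variable u = 1 - b, with its denominator
    cleared. *)
Definition beta_eqn d u : R := (d%:R + 1) * (1 - u) + ln u * (d%:R * u + 1).

Let dbeta d u : R := d%:R * ln u + u^-1 - 1.
Let ddbeta d u : R := d%:R * u^-1 - (u ^+ 2)^-1.

Let is_derive_beta_eqn d u : 0 < u -> is_derive u 1 (beta_eqn d) (dbeta d u).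
Proof.
move=> u0; have did : is_derive u (1 : R) (id : R -> R) 1 := is_derive_id u 1.
have dcst (c : R) : is_derive u (1 : R) (cst c : R -> R) 0 := is_derive_cst c u 1.
apply: (is_derive_eq (is_deriveD
  (is_deriveM (dcst (d%:R + 1)) (is_deriveB (dcst 1) did))
  (is_deriveM (is_derive1_ln u0) (is_deriveD (is_deriveM (dcst d%:R) did) (dcst 1))))).
rewrite /GRing.scale /= !fctE /= /dbeta; field.
by rewrite gt_eqF.
Qed.

Let is_derive_dbeta d u : 0 < u -> is_derive u 1 (dbeta d) (ddbeta d u).
Proof.
move=> u0; have did : is_derive u (1 : R) (id : R -> R) 1 := is_derive_id u 1.
have dcst (c : R) : is_derive u (1 : R) (cst c : R -> R) 0 := is_derive_cst c u 1.
have un0 : (id : R -> R) u != 0 by rewrite /= gt_eqF.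
apply: (is_derive_eq (is_deriveB (is_deriveD
  (is_deriveM (dcst d%:R) (is_derive1_ln u0)) (is_deriveV un0 did)) (dcst 1))).
rewrite /GRing.scale /= /ddbeta; field.
by rewrite gt_eqF.
Qed.

Lemma beta_eqn1 d : beta_eqn d 1 = 0.
Proof. by rewrite /beta_eqn ln1 subrr mulr0 mul0r addr0. Qed.

Lemma is_betaE d b : is_beta d b <-> 0 < b < 1 /\ beta_eqn d (1 - b) = 0.
Proof.
rewrite /is_beta /beta_eqn; split=> -[/andP[b0 b1]] E; split; rewrite ?b0 ?b1 //.
all: have q0 : 0 < d%:R + 1 - d%:R * b.
all: do ?[by have := ler0n R d; nra].
  by rewrite -[ln _]opprK E; field; rewrite gt_eqF.
by apply: (mulIf (lt0r_neq0 q0)); rewrite divfK ?lt0r_neq0 //; lra.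
Qed.

(** The function and its derivative both vanish at 1.  By Rolle's theorem two roots
    in the open unit interval would give two zeros of the derivative below 1, and
    so two zeros of the second derivative, whose only zero is 1 / d. *)
Lemma beta_eqn_root_unique d u v : 0 < u -> u < v -> v < 1 ->
  beta_eqn d u = 0 -> beta_eqn d v = 0 -> False.
Proof.
move=> u0 uv v1 ku kv; have v0 := lt_trans u0 uv.
have dk (x y t : R) : 0 < x -> x <= t <= y -> is_derive t 1 (beta_eqn d) (dbeta d t).
  by move=> x0 /andP[xt _]; apply: is_derive_beta_eqn; apply: lt_le_trans xt.
have ddk (x y t : R) : 0 < x -> x <= t <= y -> is_derive t 1 (dbeta d) (ddbeta d t).
  by move=> x0 /andP[xt _]; apply: is_derive_dbeta; apply: lt_le_trans xt.
have [s /andP[us sv] ds] := rolle_zero uv (fun t => dk u v t u0) (etrans ku (esym kv)).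
have [t /andP[vt t1] dt] :=
  rolle_zero v1 (fun t => dk v 1 t v0) (etrans kv (esym (beta_eqn1 d))).
have d1 : dbeta d 1 = 0 by rewrite /dbeta ln1 mulr0 add0r invr1 subrr.
have s0 := lt_trans u0 us; have st := lt_trans sv vt; have t0 := lt_trans s0 st.
have [x /andP[sx xt] dx] := rolle_zero st (fun y => ddk s t y s0) (etrans ds (esym dt)).
have [z /andP[tz z1] dz] := rolle_zero t1 (fun y => ddk t 1 y t0) (etrans dt (esym d1)).
have root_inv (y : R) : 0 < y -> ddbeta d y = 0 -> d%:R * y = 1.
  move=> y0; rewrite /ddbeta => /eqP; rewrite subr_eq0 => /eqP E.
  have -> : d%:R * y = d%:R * y^-1 * y ^+ 2 by field; rewrite gt_eqF.
  by rewrite E mulVf // expf_neq0 // gt_eqF.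
have x0 := lt_trans s0 sx; have z0 := lt_trans t0 tz.
have dE : d%:R != 0 :> R.
  by apply/eqP => dE; have /eqP := root_inv _ x0 dx; rewrite dE mul0r eq_sym oner_eq0.
have xz : x = z by apply: (mulfI dE); rewrite !root_inv.
by have := lt_trans xt tz; rewrite xz ltxx.
Qed.

(** The difference has derivative (1 - 1 / x) ^ 2 and vanishes at 1. *)
Lemma ln_ltr_half (x : R) : 1 < x -> 2 * ln x < x - x^-1.
Proof.
move=> x1; set f := fun t : R => t - t^-1 - 2 * ln t.
pose df (t : R) := (1 - t^-1) ^+ 2.
have fdf (t : R) : 1 <= t -> is_derive t 1 f (df t).
  move=> t1; have t0 : 0 < t by lra.
  have did : is_derive t (1 : R) (id : R -> R) 1 := is_derive_id t 1.
  have d2 : is_derive t (1 : R) (cst 2 : R -> R) 0 := is_derive_cst _ t 1.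
  have tn0 : (id : R -> R) t != 0 by rewrite /= gt_eqF.
  apply: (is_derive_eq (is_deriveB (is_deriveB did (is_deriveV tn0 did))
    (is_deriveM d2 (is_derive1_ln t0)))).
  by rewrite /GRing.scale /= /df; field; rewrite gt_eqF.
have [] := @MVT R f df 1 x x1.
- by move=> t; rewrite in_itv /= => /andP[t1 _]; apply: fdf; apply: ltW.
- apply: derivable_within_continuous => t; rewrite in_itv /= => /andP[/fdf + _].
  by case.
move=> t; rewrite in_itv /= => /andP[t1 _]; rewrite /f ln1 invr1 subrr mulr0 !subr0 => E.
rewrite -subr_gt0 E mulr_gt0 ?subr_gt0 // exprn_gt0 // subr_gt0.
by rewrite invf_lt1 //; lra.
Qed.

Lemma beta_eqn_ivt d u v : 0 < u -> u < v -> v < 1 ->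
  beta_eqn d u < 0 -> 0 < beta_eqn d v -> exists2 w, u < w < v & is_beta d (1 - w).
Proof.
move=> u0 uv v1 ku kv.
have [||w] := @IVT R (beta_eqn d) u v 0 (ltW uv).
- apply: derivable_within_continuous => t; rewrite in_itv /= => /andP[ut _].
  by have := is_derive_beta_eqn d (lt_le_trans u0 ut) => -[].
- by rewrite /Num.min /Num.max (lt_trans ku kv) (ltW ku) (ltW kv).
rewrite in_itv /= => /andP[uw wv] kw.
have uw' : u < w by rewrite lt_neqAle uw andbT; apply/eqP => E; move: ku; rewrite E kw ltxx.
have wv' : w < v by rewrite lt_neqAle wv andbT; apply/eqP => E; move: kv; rewrite -E kw ltxx.
exists w; first by rewrite uw'.
apply/is_betaE; split; first by apply/andP; split; lra.
by rewrite (_ : 1 - (1 - w) = w) //; ring.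
Qed.

Lemma is_beta_unique d b b' : is_beta d b -> is_beta d b' -> b = b'.
Proof.
wlog le_bb' : b b' / b <= b' => [wl B B'|].
  by have [?|/ltW ?] := leP b b'; [apply: wl | apply/esym/wl].
move: le_bb'; rewrite le_eqVlt => /orP[/eqP //|bb'].
move=> /is_betaE[/andP[b0 b1] kb] /is_betaE[/andP[b'0 b'1] kb'].
by have [] := @beta_eqn_root_unique d (1 - b') (1 - b); lra.
Qed.

(** beta_eqn d is negative at expR (- (d + 1)), where the logarithm equals
    - (d + 1), and positive at 1 / d by ln_ltr_half. *)
Lemma is_beta_beta d : (2 <= d)%N -> is_beta d (beta R d).
Proof.
move=> d2; have d2R : 2 <= d%:R :> R by rewrite ler_nat.
suff [w _ bw] : exists2 w : R, expR (- (d%:R + 1)) < w < d%:R^-1 & is_beta d (1 - w).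
  exact: (@xgetPex _ 0 [set b | is_beta d b] (ex_intro _ _ bw)).
have e0 := expR_gt0 (- (d%:R + 1) : R).
have d0 : 0 < d%:R :> R by lra.
apply: beta_eqn_ivt => //.
- rewrite expRN ltf_pV2 ?posrE ?expR_gt0 //; by have := expR_ge1Dx (d%:R + 1 : R); lra.
- by rewrite invf_lt1 //; lra.
- rewrite /beta_eqn expRK.
  have := mulr_gt0 d0 e0; have := mulr_gt0 d0 (mulr_gt0 d0 e0); nra.
- have := @ln_ltr_half d%:R; rewrite /beta_eqn lnV ?posrE // divff ?gt_eqF // => h.
  have : (d%:R + 1) * (1 - d%:R^-1) = d%:R - d%:R^-1 :> R by field; rewrite gt_eqF.
  by move=> ->; have := h _; lra.
Qed.

Lemma is_betaP d b : (2 <= d)%N -> is_beta d b <-> b = beta R d.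
Proof.
move=> d2; split=> [B|->]; last exact: is_beta_beta.
exact: is_beta_unique B (is_beta_beta d2).
Qed.

Lemma beta_between d u v : (2 <= d)%N -> 0 < u -> u < v -> v < 1 ->
  beta_eqn d u < 0 -> 0 < beta_eqn d v -> u < 1 - beta R d < v.
Proof.
move=> d2 u0 uv v1 ku kv; have [w uwv bw] := beta_eqn_ivt u0 uv v1 ku kv.
by rewrite -(is_beta_unique bw (is_beta_beta d2)) (_ : 1 - (1 - w) = w) //; ring.
Qed.
End Beta.

(** * Numerical values *)

Lemma bernoulli_ineq (R : realType) (x : R) n : -1 <= x -> 1 + n%:R * x <= (1 + x) ^+ n.
Proof.
move=> x1; elim: n => [|n IH]; first by rewrite mul0r addr0 expr0.
have x0 : 0 <= 1 + x by lra.
rewrite exprS; apply: le_trans (ler_wpM2l x0 IH).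
by have := mulr_ge0 (ler0n R n) (sqr_ge0 x); rewrite -natr1; lra.
Qed.

Section CriticalValues.
Variable R : realType.
Implicit Types (u b z : R) (d : nat).

(** The equation for beta eliminates the logarithm. *)
Lemma cstarE d : (2 <= d)%N ->
  cstar R d = (d%:R + 1) / ((d%:R + 1 - d%:R * beta R d) * beta R d ^+ d.-1).
Proof.
move=> d2; have [/andP[b0 b1] E] := is_beta_beta R d2.
have q0 : 0 < d%:R + 1 - d%:R * beta R d by have := ler0n R d; nra.
rewrite /cstar E -(prednK (ltnW d2)) exprS prednK ?(ltnW d2) //; field.
by rewrite expf_neq0 ?gt_eqF.
Qed.

(** Any z at least equal to (d + 1) (1 - u) / (d u + 1) with u * expR z < 1 reduces
    the sign of beta_eqn to a bound on one exponential; beta_eqn_gt0 is the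
    opposite case. *)
Lemma beta_eqn_lt0 d u z : 0 < u -> (d%:R + 1) * (1 - u) <= z * (d%:R * u + 1) ->
  u * expR z < 1 -> beta_eqn d u < 0.
Proof.
move=> u0 le_z lt1; have lnu : ln u < - z.
  by rewrite -(expRK (- z)) ltr_ln ?posrE ?expR_gt0 // expRN -[_^-1]mul1r ltr_pdivlMr ?expR_gt0.
have q0 : 0 < d%:R * u + 1 by have := mulr_ge0 (ler0n R d) (ltW u0); lra.
by rewrite /beta_eqn; have := ltr_pM2r q0 (ln u) (- z); rewrite lnu; lra.
Qed.

Lemma beta_eqn_gt0 d u z : 0 < u -> z * (d%:R * u + 1) <= (d%:R + 1) * (1 - u) ->
  1 < u * expR z -> 0 < beta_eqn d u.
Proof.
move=> u0 le_z lt1; have lnu : - z < ln u.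
  by rewrite -(expRK (- z)) ltr_ln ?posrE ?expR_gt0 // expRN -[_^-1]mul1r ltr_pdivrMr ?expR_gt0.
have q0 : 0 < d%:R * u + 1 by have := mulr_ge0 (ler0n R d) (ltW u0); lra.
by rewrite /beta_eqn; have := ltr_pM2r q0 (- z) (ln u); rewrite lnu; lra.
Qed.

Lemma exp_horner_le n z : 0 <= z -> exp_horner n 1 z <= expR z.
Proof. by move=> z0; rewrite -exp_polyE exp_poly_le. Qed.

Lemma le_exp_horner n z : 0 <= z -> z <= n.+1%:R / 2 ->
  expR z <= 2 * exp_horner n.+1 1 z - exp_horner n 1 z.
Proof.
move=> z0 zn; apply: le_trans (le_exp_poly z0 zn) _.
by rewrite -!exp_polyE /=; lra.
Qed.

(** At lo the number z1 separates - ln (1 - lo) from the larger value that the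
    equation prescribes for it; at hi the order is reversed, and z2 separates the
    two.  Taylor polynomials of degree about n decide on which side of z1 and z2
    the logarithms lie. *)
Lemma beta_enclosure n d lo hi z1 z2 : (2 <= d)%N -> 0 < lo -> lo < hi -> hi < 1 ->
    0 <= z1 -> z1 * (d%:R * (1 - lo) + 1) <= (d%:R + 1) * lo ->
    1 < (1 - lo) * exp_horner n 1 z1 ->
    0 <= z2 -> z2 <= n.+1%:R / 2 -> (d%:R + 1) * hi <= z2 * (d%:R * (1 - hi) + 1) ->
    (1 - hi) * (2 * exp_horner n.+1 1 z2 - exp_horner n 1 z2) < 1 ->
  lo < beta R d < hi.
Proof.
move=> d2 lo0 lohi hi1 z1_ge0 z1_le lt_lo z2_ge0 z2_le le_z2 lt_hi.
have u_hi : 0 < 1 - hi by lra.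
have u_lo : 0 < 1 - lo by lra.
have k_hi : beta_eqn d (1 - hi) < 0.
  apply: (beta_eqn_lt0 (z := z2)) => //.
    by rewrite (_ : 1 - (1 - hi) = hi) //; ring.
  apply: le_lt_trans lt_hi; rewrite ler_wpM2l ?le_exp_horner //; exact: ltW.
have k_lo : 0 < beta_eqn d (1 - lo).
  apply: (beta_eqn_gt0 (z := z1)) => //.
    by rewrite (_ : 1 - (1 - lo) = lo) //; ring.
  apply: lt_le_trans lt_lo _; rewrite ler_wpM2l ?exp_horner_le //; exact: ltW.
have := @beta_between R d (1 - hi) (1 - lo) d2 u_hi _ _ k_hi k_lo; lra.
Qed.

Lemma beta2_bounds : 8834 / 10 ^+ 4 + 135 / 10 ^+ 7 < beta R 2 < 8834 / 10 ^+ 4 + 145 / 10 ^+ 7.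
Proof.
apply: (@beta_enclosure 18 2 _ _
  (2149 / 10 ^+ 3 + 1225 / 10 ^+ 7) (2149 / 10 ^+ 3 + 1295 / 10 ^+ 7));
  first exact: isT; rewrite /exp_horner; lra.
Qed.

Lemma beta3_bounds : 9724 / 10 ^+ 4 + 980 / 10 ^+ 7 < beta R 3 < 9724 / 10 ^+ 4 + 985 / 10 ^+ 7.
Proof.
apply: (@beta_enclosure 18 3 _ _
  (3593 / 10 ^+ 3 + 5050 / 10 ^+ 7) (3593 / 10 ^+ 3 + 5135 / 10 ^+ 7));
  first exact: isT; rewrite /exp_horner; lra.
Qed.

Lemma ler_dist_div (x q c e : R) : 0 < q -> (c - e) * q <= x -> x <= (c + e) * q ->
  `|x / q - c| <= e.
Proof.
move=> q0 lo hi; have {}lo : c - e <= x / q by rewrite ler_pdivlMr.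
have {}hi : x / q <= c + e by rewrite ler_pdivrMr.
by rewrite ler_norml; lra.
Qed.

Lemma cstar2_bounds :
  `|cstar R 2 - (275 / 10 ^+ 2 + 381 / 10 ^+ 5)| <= 10 ^- 5 / 2.
Proof.
rewrite cstarE //= expr1; have /andP[] := beta2_bounds.
move: (beta R 2) => b lo hi.
pose l : R := 8834 / 10 ^+ 4 + 135 / 10 ^+ 7; pose t := b - l.
have t0 : 0 <= t by rewrite subr_ge0 ltW.
have t1 : t <= 10 ^- 6 by rewrite /t /l; clear -hi; lra.
have bE : b = l + t by rewrite /t; ring.
have tt0 : 0 <= t * t by apply: mulr_ge0.
have tt1 : t * t <= 10 ^- 6 * t by apply: ler_wpM2r.
have q0 : 0 < (2 + 1 - 2 * b) * b by rewrite mulr_gt0 //; clear -lo hi; lra.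
apply: ler_dist_div => //; rewrite bE /l; clear -t0 t1 tt0 tt1; lra.
Qed.

Lemma cstar3_bounds :
  `|cstar R 3 - (390 / 10 ^+ 2 + 708 / 10 ^+ 5)| <= 10 ^- 5 / 2.
Proof.
rewrite cstarE //=; have /andP[] := beta3_bounds.
move: (beta R 3) => b lo hi.
have b0 : 0 < b by clear -lo; lra.
have q1 : 4 - 3 * (9724 / 10 ^+ 4 + 985 / 10 ^+ 7) <= 3 + 1 - 3 * b by clear -hi; lra.
have q2 : 3 + 1 - 3 * b <= 4 - 3 * (9724 / 10 ^+ 4 + 980 / 10 ^+ 7) by clear -lo; lra.
have q0 : 0 < 3 + 1 - 3 * b by clear -hi; lra.
have b1 : (9724 / 10 ^+ 4 + 980 / 10 ^+ 7) ^+ 2 <= b ^+ 2.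
  by apply: lerXn2r; rewrite ?nnegrE; [clear; lra | exact: ltW | exact: ltW].
have b2 : b ^+ 2 <= (9724 / 10 ^+ 4 + 985 / 10 ^+ 7) ^+ 2.
  by apply: lerXn2r; rewrite ?nnegrE; [exact: ltW | clear; lra | exact: ltW].
apply: ler_dist_div; first by rewrite mulr_gt0 ?exprn_gt0.
  apply: le_trans (ler_wpM2l _ (ler_pM (ltW q0) (sqr_ge0 b) q2 b2)) _; clear; lra.
apply: le_trans (ler_wpM2l _ (ler_pM _ _ q1 b1)); clear; lra.
Qed.
End CriticalValues.

(** * Expansions for large d, and the sign of the excess *)

(** Notations: m = d + 1, eps = expR (- m), u = 1 - beta, and s = 2 m ^ 2 eps, the
    small parameter in terms of which all errors are measured. *)
Section Asymptotics.
Variable R : realType.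
Implicit Types d : nat.

Let m d : R := d%:R + 1.
Let eps d : R := expR (- m d).
Let s d : R := 2 * m d ^+ 2 * eps d.
Let u d : R := 1 - beta R d.

Let m_gt0 d : 0 < m d. Proof. by rewrite /m; have := ler0n R d; lra. Qed.
Let eps_gt0 d : 0 < eps d. Proof. exact: expR_gt0. Qed.
Let s_gt0 d : 0 < s d. Proof. by rewrite !mulr_gt0 // exprn_gt0. Qed.

(** From expR m >= m ^ 4 / 4!. *)
Let s_le d : s d <= 48 * (d.+1%:R)^-1.
Proof.
have mE : m d = d.+1%:R by rewrite /m natr1.
have m1 : 1 <= m d by rewrite mE ler1n.
rewrite -mE /s /eps expRN -lef_pV2 ?posrE; last 2 first.
- by rewrite !mulr_gt0 ?invr_gt0 ?exprn_gt0.
- by rewrite !mulr_gt0 ?invr_gt0 ?exprn_gt0 ?expR_gt0.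
have -> : (48 * (m d)^-1)^-1 = m d / 48 by field; rewrite gt_eqF.
have -> : (2 * m d ^+ 2 * (expR (m d))^-1)^-1 = 2^-1 * (m d ^+ 2)^-1 * expR (m d).
  by field; rewrite !gt_eqF ?expR_gt0.
have := @expR_ge1Dxn R (m d) 3 (ltW (m_gt0 d)).
rewrite (_ : 4`!%:R = 24 :> R) // => exp_ge.
have m2_ge0 := sqr_ge0 (m d).
have le1 : m d / 48 <= m d ^+ 2 / 48.
  by rewrite ler_wpM2r ?invr_ge0 // expr2 ler_peMl // (le_trans _ m1).
apply: le_trans le1 _.
have e_ge : m d ^+ 4 / 24 <= expR (m d) by lra.
have -> : m d ^+ 2 / 48 = 2^-1 * (m d ^+ 2)^-1 * (m d ^+ 4 / 24).
  by field; rewrite gt_eqF.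
by apply: ler_wpM2l => //; rewrite mulr_ge0 ?invr_ge0.
Qed.

Let s_cvg : s d @[d --> \oo] --> (0 : R).
Proof.
apply: (@squeeze_cvgr _ _ _ _ (fun=> 0) (fun d => 48 * (d.+1%:R)^-1)).
- by apply: nearW => d; rewrite (ltW (s_gt0 d)) s_le.
- exact: cvg_cst.
- by rewrite -[0](mulr0 48); apply: cvgMl_tmp; apply: cvg_harmonic.
Qed.

Let s_small : \forall d \near \oo, (2 <= d)%N /\ s d <= 1 / 2.
Proof.
near=> d; split; first by near: d; apply: nbhs_infty_ge.
by near: d; apply: (cvgr_le (0 : R)) => //; rewrite divr_gt0.
Unshelve. all: by end_near. Qed.

Section Bounds.
Variable d : nat.
Hypotheses (d2 : (2 <= d)%N) (s1 : s d <= 1 / 2).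

Let d2R : 2 <= d%:R :> R. Proof. by rewrite ler_nat. Qed.

(** beta_eqn d is negative at eps, and positive at 2 eps because there it equals
    ln 2 (1 + 2 d eps) - s, with ln 2 >= 1 / 2 >= s. *)
Let u_bounds : eps d < u d < 2 * eps d.
Proof.
have e0 := eps_gt0 d; have m0 := m_gt0 d.
have e1 : 2 * eps d < 1.
  have : 9 <= m d ^+ 2 by rewrite /m; have := d2R; nra.
  by move=> m9; have := ler_wpM2r (ltW e0) m9; move: s1; rewrite /s; lra.
apply: beta_between => //; first by lra.
  rewrite /beta_eqn /eps expRK -/(eps d) /m -/(eps d).
  by have := mulr_gt0 m0 (mulr_gt0 m0 e0); rewrite /m; lra.
rewrite /beta_eqn lnM ?posrE // /eps expRK -/(eps d).
have ln2 : 1 / 2 <= ln 2 :> R.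
  by have := @le_ln1Dx R (- (1 / 2)); rewrite (_ : 1 + - (1 / 2) = 2^-1) ?lnV ?posrE //; lra.
have q0 : 0 < d%:R * (2 * eps d) by rewrite !mulr_gt0 //; have := d2R; lra.
have := ler_wpM2r (ltW q0) ln2; move: s1; rewrite /s /m; lra.
Qed.

Let y : R := m d ^+ 2 * u d / (1 + d%:R * u d).

Let u_gt0 : 0 < u d. Proof. by case/andP: u_bounds => /(lt_trans (eps_gt0 d)). Qed.

Let q_gt0 : 0 < 1 + d%:R * u d.
Proof. by have := mulr_ge0 (ler0n R d) (ltW u_gt0); lra. Qed.

(** The equation for beta reads ln u = - m + y. *)
Let uE : u d = eps d * expR y.
Proof.
have [_] := is_beta_beta R d2; rewrite -/(u d) => E.
have bE : beta R d = 1 - u d by rewrite /u; ring.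
rewrite -[LHS](@lnK R) ?posrE // -expRD; congr expR.
rewrite -[LHS]opprK E bE /y /m; field.
rewrite (_ : _ + _ = 1 + d%:R * u d) ?gt_eqF //; ring.
Qed.

Let y_le : y <= m d ^+ 2 * u d.
Proof.
rewrite ler_pdivrMr //; apply: ler_peMr; first by rewrite mulr_ge0 ?sqr_ge0 // ltW.
by have := mulr_ge0 (ler0n R d) (ltW u_gt0); lra.
Qed.

Let mu_le : m d ^+ 2 * u d <= s d.
Proof.
have /andP[_ /ltW h] := u_bounds.
by have := ler_wpM2l (sqr_ge0 (m d)) h; rewrite /s; lra.
Qed.

Let exp_sub1_le : expR y - 1 <= y * expR y.
Proof.
have := ler_wpM2l (expR_ge0 y) (expR_ge1Dx (- y)).
by rewrite -expRD subrr expR0; lra.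
Qed.

(** The quotient equals (expR y - 1) / (m ^ 2 eps), and y is close to
    m ^ 2 eps since u = eps * expR y. *)
Lemma beta_expansion :
  1 - s d <= (1 - eps d - beta R d) / (m d ^+ 2 * eps d ^+ 2) <= expR (2 * s d).
Proof.
have e0 := eps_gt0 d; have m0 := m_gt0 d.
have -> : (1 - eps d - beta R d) / (m d ^+ 2 * eps d ^+ 2) =
    (expR y - 1) / (m d ^+ 2 * eps d).
  have -> : 1 - eps d - beta R d = eps d * (expR y - 1).
    by rewrite mulrBr -uE /u; ring.
  by field; rewrite !gt_eqF.
have me0 : 0 < m d ^+ 2 * eps d by rewrite mulr_gt0 ?exprn_gt0.
have /andP[u1 u2] := u_bounds.
rewrite ler_pdivlMr // ler_pdivrMr //; apply/andP; split.
  apply: (@le_trans _ _ y); last by have := expR_ge1Dx y; lra.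
  rewrite /y ler_pdivlMr //.
  have du : d%:R * u d <= s d.
    apply: le_trans mu_le; apply: ler_wpM2r; first exact: ltW.
    by rewrite /m; have := d2R; nra.
  have : (1 - s d) * (1 + d%:R * u d) <= 1.
    by have := s_gt0 d; have := q_gt0; nra.
  move=> /(ler_wpM2l (ltW me0)); have := ler_wpM2l (sqr_ge0 (m d)) (ltW u1); lra.
apply: le_trans exp_sub1_le _.
have ys : y <= s d := le_trans y_le mu_le.
apply: (@le_trans _ _ (m d ^+ 2 * eps d * expR y * expR y)).
  by rewrite ler_wpM2r ?expR_ge0 // -mulrA -uE.
rewrite -mulrA -expRD [leRHS]mulrC ler_wpM2l ?ler_expR ?(ltW me0) //; lra.
Qed.

(** With k = d - 1, cstar = m / ((1 + d u) (1 - u) ^ k), where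
    Bernoulli's inequality gives 1 + u up to terms in m ^ 2 u ^ 2 for the denominator;
    then u differs from eps by at most 4 m ^ 2 eps ^ 2. *)
Lemma cstar_expansion :
  `|cstar R d - (m d - m d * eps d)| <= 4 * m d ^+ 3 * eps d ^+ 2.
Proof.
have e0 := eps_gt0 d; have m0 := m_gt0 d.
have /andP[u1 u2] := u_bounds; have u0 := u_gt0.
have [k dk] : exists k, d = k.+1 by exists d.-1; rewrite prednK // ltnW.
have dkR : d%:R = k%:R + 1 :> R by rewrite dk natr1.
have k0 := ler0n R k.
have bE : beta R d = 1 - u d by rewrite /u; ring.
have ms : m d ^+ 2 * u d <= 1 / 2 := le_trans mu_le s1.
have [ku uu1] : k%:R * u d <= 1 / 2 /\ u d <= 1 / 2.
  have [km m1] : k%:R <= m d ^+ 2 /\ 1 <= m d ^+ 2 by rewrite /m dkR; split; nra.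
  split; first exact: le_trans (ler_wpM2r (ltW u0) km) ms.
  by rewrite -[leLHS]mul1r; apply: le_trans (ler_wpM2r (ltW u0) m1) ms.
have cE : cstar R d = m d / ((1 + d%:R * u d) * (1 - u d) ^+ k).
  have kE : d.-1 = k by rewrite dk.
  rewrite cstarE // bE kE /m; congr (_ / (_ * _)); ring.
have pow_gt0 : 0 < (1 - u d) ^+ k by rewrite exprn_gt0 //; lra.
have Q0 : 0 < (1 + d%:R * u d) * (1 - u d) ^+ k by rewrite mulr_gt0.
have lo : m d * (1 - u d) <= cstar R d.
  rewrite cE ler_pdivlMr // -[leRHS]mulr1 -mulrA; apply: ler_wpM2l; first exact: ltW.
  rewrite mulrCA -exprS -dk.
  apply: (@le_trans _ _ ((1 + u d) ^+ d * (1 - u d) ^+ d)).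
    rewrite ler_wpM2r ?exprn_ge0 //; first by lra.
    by apply: bernoulli_ineq; lra.
  by rewrite -exprMn exprn_ile1 //; nra.
have hi : cstar R d <= m d * (1 - u d + m d ^+ 2 * u d ^+ 2).
  rewrite cE ler_pdivrMr // -[leLHS]mulr1 -mulrA; apply: ler_wpM2l; first exact: ltW.
  have B0 : 0 <= 1 - u d + m d ^+ 2 * u d ^+ 2.
    by have := mulr_ge0 (sqr_ge0 (m d)) (sqr_ge0 (u d)); lra.
  have pow_ge : 1 - k%:R * u d <= (1 - u d) ^+ k.
    by have := @bernoulli_ineq R (- u d) k; rewrite mulrN; apply; lra.
  apply: (@le_trans _ _ ((1 - u d + m d ^+ 2 * u d ^+ 2) *
      ((1 + d%:R * u d) * (1 - k%:R * u d)))); last first.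
    by rewrite ler_wpM2l // ler_wpM2l // ltW.
  have h1 : 0 <= u d ^+ 2 * (3 * k%:R + 3).
    by rewrite mulr_ge0 ?sqr_ge0 //; lra.
  have h2 : 0 <= u d ^+ 3 * (m d ^+ 2 + d%:R * k%:R * (1 - m d ^+ 2 * u d)).
    rewrite mulr_ge0 ?exprn_ge0 ?(ltW u0) // addr_ge0 ?sqr_ge0 //.
    by rewrite !mulr_ge0 //; lra.
  rewrite -subr_ge0; move: (addr_ge0 h1 h2).
  by rewrite /m dkR; lra.
have ue : u d - eps d <= 4 * m d ^+ 2 * eps d ^+ 2.
  have -> : u d - eps d = eps d * (expR y - 1) by rewrite mulrBr -uE mulr1.
  have := ler_wpM2l (ltW e0) exp_sub1_le; rewrite mulrCA -uE => h; apply: le_trans h _.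
  have := ler_wpM2r (ltW u0) y_le => h; apply: le_trans h _.
  have uu : u d * u d <= 4 * eps d ^+ 2 by nra.
  by have := ler_wpM2l (sqr_ge0 (m d)) uu; lra.
have m3 : 0 <= m d ^+ 3 by rewrite exprn_ge0 // ltW.
rewrite ler_norml lerBrDl lerBlDl; apply/andP; split.
  by have := ler_wpM2l (ltW m0) ue; lra.
have uu : u d ^+ 2 <= 4 * eps d ^+ 2 by nra.
by have := ler_wpM2l m3 uu; have := ler_wpM2l (ltW m0) (ltW u1); lra.
Qed.
End Bounds.

Lemma cstar_bigO :
  (fun d : nat => cstar R d - ((d%:R + 1) - (d%:R + 1) / expR (d%:R + 1)))
    =O_\oo (fun d : nat => d%:R ^+ 3 / expR (2 * d%:R)).
Proof.
have gt0 : 0 < 32 :> R by rewrite ltr0n.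
apply/eqO_exP; exists 32; first exact: gt0.
near=> d.
have [d2 s1] : (2 <= d)%N /\ s d <= 1 / 2 by near: d; exact: s_small.
have := cstar_expansion d2 s1; rewrite /eps expRN -/(m d) => /le_trans; apply.
rewrite ger0_norm; last by rewrite divr_ge0 ?exprn_ge0 ?expR_ge0.
have d1R : 1 <= d%:R :> R by rewrite ler1n ltnW.
have le_m : m d ^+ 3 <= 8 * d%:R ^+ 3.
  rewrite (_ : 8 * _ = (2 * d%:R) ^+ 3); last by ring.
  by apply: lerXn2r; rewrite ?nnegrE ?(ltW (m_gt0 d)) ?mulr_ge0 // /m; lra.
have le_e : (expR (m d))^-1 ^+ 2 <= (expR (2 * d%:R))^-1.
  rewrite exprVn lef_pV2 ?posrE ?exprn_gt0 ?expR_gt0 //.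
  by rewrite -expRM_natl ler_expR /m; lra.
have := ler_pM (exprn_ge0 3 (ltW (m_gt0 d))) (sqr_ge0 _) le_m le_e.
by move: (expR _)^-1 (expR _)^-1 => e e'; lra.
Unshelve. all: by end_near. Qed.

Lemma beta_littleo :
  exists o : nat -> R, o @ \oo --> (0 : R) /\
    forall d : nat, (2 <= d)%N ->
      beta R d = 1 - expR (- (d%:R + 1))
        - (1 + o d) * ((d%:R + 1) ^+ 2 / expR (2 * (d%:R + 1))).
Proof.
exists (fun d => (1 - eps d - beta R d) / (m d ^+ 2 * eps d ^+ 2) - 1); split.
  apply: (@squeeze_cvgr _ _ _ _ (fun d => - s d) (fun d => expR (2 * s d) - 1)).
  - near=> d.
    have [d2 s1] : (2 <= d)%N /\ s d <= 1 / 2 by near: d; exact: s_small.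
    have := beta_expansion d2 s1; lra.
  - by rewrite -[0 in X in _ --> X]oppr0; apply: cvgN s_cvg.
  - rewrite -[0 in X in _ --> X](subrr 1); apply: cvgB; last exact: cvg_cst.
    rewrite -[1 in X in _ --> X](@expR0 R) -[0 in X in _ --> X](mulr0 2).
    apply: (@continuous_cvg _ _ _ _ _ _ expR); first exact: continuous_expR.
    exact: cvgMl_tmp s_cvg.
move=> d _; rewrite expRM_natl -[expR (d%:R + 1)]invrK -expRN -/(m d) -/(eps d) exprVn invrK.
have m0 := m_gt0 d; have e0 := eps_gt0 d.
by field; rewrite !gt_eqF.
Unshelve. all: by end_near. Qed.

(** Put L = - ln (1 - b).  The equation for b says that the right-hand side vanishes
    when c * b ^ d = L, that is at c = cstar.  If c * b ^ d exceeds L by D, the bound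
    expR (- D) >= 1 - D leaves at least D b / (d + 1). *)
Lemma cstar_excess d (c : R) : (2 <= d)%N -> cstar R d < c ->
  0 < expR (- (c * beta R d ^+ d)) - 1 + c / d.+1%:R *
    (1 - (1 - d.+1%:R * beta R d ^+ d + d%:R * beta R d ^+ d.+1)).
Proof.
move=> d2; have [/andP[b0 b1]] := is_beta_beta R d2; rewrite /cstar.
move: (beta R d) b0 b1 => b b0 b1.
set L := - ln (1 - b) => LE; have bd0 : 0 < b ^+ d by rewrite exprn_gt0.
rewrite ltr_pdivrMr // => Lc; pose D := c * b ^+ d - L.
have D0 : 0 < D by rewrite subr_gt0.
have m0 : 0 < d%:R + 1 :> R by exact: m_gt0.
have q0 : 0 < d%:R + 1 - d%:R * b by have := ler0n R d; nra.
have eE : expR (- (c * b ^+ d)) = (1 - b) * expR (- D).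
  rewrite (_ : - (c * b ^+ d) = ln (1 - b) - D); last by rewrite /D /L; ring.
  by rewrite expRD lnK // posrE subr_gt0.
have ge_e : (1 - b) * (1 - D) <= (1 - b) * expR (- D).
  by rewrite ler_wpM2l ?subr_ge0 ?(ltW b1) ?expR_ge1Dx.
rewrite eE (_ : c / _ * _ = (L + D) * (d%:R + 1 - d%:R * b) / (d%:R + 1)); last first.
  by rewrite /D -natr1 exprS; field; rewrite gt_eqF.
rewrite (_ : _ / _ = b + D * (d%:R + 1 - d%:R * b) / (d%:R + 1)); last first.
  by rewrite LE; field; rewrite !gt_eqF.
have -> : D * (d%:R + 1 - d%:R * b) / (d%:R + 1) = D * (1 - b) + D * b / (d%:R + 1).
  by field; rewrite gt_eqF.
have : 0 < D * b / (d%:R + 1) by rewrite divr_gt0 ?mulr_gt0.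
by move: (expR _) (_ / _) ge_e => e f; lra.
Qed.

Lemma cstar_gt0 d : (2 <= d)%N -> 0 < cstar R d.
Proof.
move=> d2; have [/andP[b0 b1] _] := is_beta_beta R d2.
rewrite /cstar divr_gt0 ?exprn_gt0 // oppr_gt0 ln_lt0 //.
by apply/andP; split; lra.
Qed.
End Asymptotics.

(** * The theorem *)

Theorem theorem1p1 (R : realType) :
  [/\ (forall (d : nat), (2 <= d)%N ->
         forall b : R, is_beta d b <-> b = beta R d),
      (forall (d : nat) (F : fieldType) (c : R), (2 <= d)%N -> cstar R d < c ->
         (fun n : nat => prob_Xd d (c / n%:R)
            (fun X : {set {set 'I_n}} => exists h : homology F X d, h != 0))
         @ \oo --> (1 : R)),
      [/\ `|cstar R 2 - (275 / 10 ^+ 2 + 381 / 10 ^+ 5)| <= 10 ^- 5 / 2,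
          `|cstar R 3 - (390 / 10 ^+ 2 + 708 / 10 ^+ 5)| <= 10 ^- 5 / 2,
          `|beta R 2 - (883 / 10 ^+ 3 + 414 / 10 ^+ 6)| <= 10 ^- 6 / 2 &
          `|beta R 3 - (972 / 10 ^+ 3 + 498 / 10 ^+ 6)| <= 10 ^- 6 / 2],
      (fun d : nat => cstar R d
          - ((d%:R + 1) - (d%:R + 1) / expR (d%:R + 1)))
        =O_\oo (fun d : nat => d%:R ^+ 3 / expR (2 * d%:R)) &
      exists o : nat -> R, o @ \oo --> (0 : R) /\
        forall d : nat, (2 <= d)%N ->
          beta R d = 1 - expR (- (d%:R + 1))
            - (1 + o d) * ((d%:R + 1) ^+ 2 / expR (2 * (d%:R + 1)))].
Proof.
split.
- by move=> d d2 b; apply: is_betaP.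
- move=> [//|k] F c d2 lt_c; have [/andP[/ltW b0 _] _] := is_beta_beta R d2.
  apply: (prob_homology_cvg F _ b0); last exact: cstar_excess.
  exact: lt_trans (cstar_gt0 R d2) lt_c.
- split; [exact: cstar2_bounds | exact: cstar3_bounds | |].
    by have := beta2_bounds R; move: (beta R 2) => b /andP[lo hi]; rewrite ler_norml; lra.
  by have := beta3_bounds R; move: (beta R 3) => b /andP[lo hi]; rewrite ler_norml; lra.
- exact: cstar_bigO.
- exact: beta_littleo.
Qed.
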